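(* Let $G$ be a finite graph. Then the diagonal part of $\mathrm{MH}^*_*(G)$, by which we mean the graded subring consisting of the groups $\mathrm{MH}^k_k(G)$ for $k\geq0$, is isomorphic (as a graded ring) to the quotient of the path algebra of $G$ by the relations \[ \sum_{y\colon d(x,y)=d(y,z)=1}xyz=0 \] for each pair of vertices $x,z$ with $d(x,z)=2$.
   Context: Graphs are undirected, without loops or multiple edges, and are regarded as extended metric spaces by equipping the vertex set with the shortest-path metric $d$ ($d(x,y)=\infty$ if there is no path from $x$ to $y$). Path algebra: an edge path in $G$ is a sequence $x_0\cdots x_k$ ($k\geq0$) of vertices such that each consecutive pair $x_{i-1},x_i$ spans an edge. The path algebra of $G$ is the $\mathbb{Z}$-algebra with basis the edge paths and multiplication $(x_0\cdots x_k)\cdot(y_0\cdots y_l)=x_0\cdots x_ky_1\cdots y_l$ if $x_k=y_0$ and $0$ otherwise, graded by path length $k$. The quotient by the relations is the quotient by the two-sided ideal they generate. Magnitude cohomology ring of an extended metric space $X$ with metric $d$: a $k$-simplex ($k\ge 0$) in $X$ is a tuple $(x_0,\ldots,x_k)\in X^{k+1}$ with $x_{i-1}\neq x_i$ for all $i$; its length is $\ell(x_0,\ldots,x_k)=d(x_0,x_1)+\cdots+d(x_{k-1},x_k)$. For $\ell\in[0,\infty)$, $\mathrm{MC}_{k,\ell}(X)$ is the free abelian group on the $k$-simplices of length $\ell$, with differential $\partial=\sum_{i=1}^{k-1}(-1)^i\partial_i\colon \mathrm{MC}_{k,\ell}(X)\to\mathrm{MC}_{k-1,\ell}(X)$, where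 $\partial_i(x_0,\ldots,x_k)=(x_0,\ldots,\widehat{x_i},\ldots,x_k)$ if $d(x_{i-1},x_{i+1})=d(x_{i-1},x_i)+d(x_i,x_{i+1})$ and $0$ otherwise. The magnitude cochain complex is $\mathrm{MC}^k_\ell(X)=\mathrm{Hom}(\mathrm{MC}_{k,\ell}(X),\mathbb{Z})$ with differential $\partial^*\varphi=\varphi\circ\partial$, and $\mathrm{MH}^k_\ell(X)=H^k(\mathrm{MC}^*_\ell(X))$. For $\varphi\in\mathrm{MC}^{k_1}_{\ell_1}(X)$ and $\psi\in\mathrm{MC}^{k_2}_{\ell_2}(X)$, the product $\varphi\cdot\psi\in\mathrm{MC}^{k_1+k_2}_{\ell_1+\ell_2}(X)$ sends a simplex $(x_0,\ldots,x_{k_1+k_2})$ of length $\ell_1+\ell_2$ to $\varphi(x_0,\ldots,x_{k_1})\,\psi(x_{k_1},\ldots,x_{k_1+k_2})$ if $\ell(x_0,\ldots,x_{k_1})=\ell_1$ and $\ell(x_{k_1},\ldots,x_{k_1+k_2})=\ell_2$, and to $0$ otherwise. The unit is the cochain $u\in\mathrm{MC}^0_0(X)$ with $u(x_0)=1$ for every $0$-simplex. This makes $\mathrm{MH}^*_*(X)$ into an associative unital bigraded ring. For a graph, $\mathrm{MH}^k_\ell(G)$ is nonzero only for integers $k,\ell\geq0$. *)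

(* Defs.v *)
From HB Require Import structures.
From mathcomp Require Import all_boot all_algebra.
From mathcomp Require Import boolp finmap monalg.
From mathcomp Require Import zify.

Set Implicit Arguments.
Unset Strict Implicit.
Unset Printing Implicit Defensive.

Import GRing.Theory.
Local Open Scope ring_scope.

(* ring_quotient.v only provides ring structures on quotients of commutative
   rings by proper ideals. *)

Section QuotientRing.
Variable R : pzRingType.

Definition is_ideal (I : R -> Prop) : Prop :=
  [/\ I 0, forall x y, I x -> I y -> I (x - y),
      forall a x, I x -> I (a * x) & forall a x, I x -> I (x * a)].

Variable S : R -> Prop.

Definition ideal_gen : {pred R} := fun r =>
  `[< forall I : R -> Prop, is_ideal I -> (forall s, S s -> I s) -> I r >].

Lemma ideal_genP r : reflect
  (forall I : R -> Prop, is_ideal I -> (forall s, S s -> I s) -> I r)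
  (r \in ideal_gen).
Proof. exact: asboolP. Qed.

Lemma ideal_gen_zmod_closed : zmod_closed ideal_gen.
Proof.
split=> [|x y /ideal_genP Ix /ideal_genP Iy]; apply/ideal_genP => I idI SI.
  by case: idI.
by case: (idI) => _ subI _ _; apply: subI; [apply: Ix|apply: Iy].
Qed.

HB.instance Definition _ :=
  GRing.isZmodClosed.Build R ideal_gen ideal_gen_zmod_closed.

Lemma ideal_genMl a x : x \in ideal_gen -> a * x \in ideal_gen.
Proof.
move=> /ideal_genP Ix; apply/ideal_genP => I idI SI.
by case: (idI) => _ _ mulI _; apply: mulI; apply: Ix.
Qed.

Lemma ideal_genMr a x : x \in ideal_gen -> x * a \in ideal_gen.
Proof.
move=> /ideal_genP Ix; apply/ideal_genP => I idI SI.
by case: (idI) => _ _ _ mulI; apply: mulI; apply: Ix.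
Qed.

Definition quotring := Quotient.quot ideal_gen.
HB.instance Definition _ := GRing.Zmodule.on quotring.

Definition qproj (x : R) : quotring := \pi_(Quotient.quot ideal_gen)%qT x.

Lemma qproj_surj (q : quotring) : exists x, q = qproj x.
Proof. by exists (repr q); rewrite /qproj reprK. Qed.

Lemma qprojD x y : qproj (x + y) = qproj x + qproj y.
Proof. exact: (@pi_addr _ _ _ _ _ (Quotient.quot ideal_gen)). Qed.

Lemma qproj_eq x y : (qproj x = qproj y) <-> (x - y \in ideal_gen).
Proof. by split=> [/eqP|h]; [|apply/eqP]; rewrite -Quotient.idealrBE. Qed.

Definition qone : quotring := qproj 1.
Definition qmul (a b : quotring) : quotring := qproj (repr a * repr b).

Lemma qprojM x y : qproj (x * y) = qmul (qproj x) (qproj y).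
Proof.
apply/qproj_eq.
have rx z : z - repr (qproj z) \in ideal_gen by apply/qproj_eq; rewrite [RHS]reprK.
rewrite -[x * y](subrK (repr (qproj x) * y)) -addrA -mulrBl -mulrBr.
by apply: rpredD; [apply: ideal_genMr|apply: ideal_genMl]; apply: rx.
Qed.

Lemma qmulA : associative qmul.
Proof.
move=> a b c; have [x ->] := qproj_surj a; have [y ->] := qproj_surj b.
by have [z ->] := qproj_surj c; rewrite -!qprojM mulrA.
Qed.

Lemma qmul1 : left_id qone qmul.
Proof. by move=> a; have [x ->] := qproj_surj a; rewrite -qprojM mul1r. Qed.

Lemma qmulr1 : right_id qone qmul.
Proof. by move=> a; have [x ->] := qproj_surj a; rewrite -qprojM mulr1. Qed.

Lemma qmulDl : left_distributive qmul +%R.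
Proof.
move=> a b c; have [x ->] := qproj_surj a; have [y ->] := qproj_surj b.
by have [z ->] := qproj_surj c; rewrite -qprojD -!qprojM mulrDl qprojD.
Qed.

Lemma qmulDr : right_distributive qmul +%R.
Proof.
move=> a b c; have [x ->] := qproj_surj a; have [y ->] := qproj_surj b.
by have [z ->] := qproj_surj c; rewrite -qprojD -!qprojM mulrDr qprojD.
Qed.

HB.instance Definition _ := GRing.Zmodule_isPzRing.Build quotring
  qmulA qmul1 qmulr1 qmulDl qmulDr.

End QuotientRing.

(* Distances take values in option nat, None standing for infinity. *)
Definition oadd (a b : option nat) : option nat :=
  if a is Some m then (if b is Some n then Some (m + n)%N else None) else None.

Lemma oaddA : associative oadd.
Proof. by case=> [?|] [?|] [?|] //=; rewrite addnA. Qed.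

Lemma oadd0 : left_id (Some 0%N) oadd. Proof. by case. Qed.

Section GraphDistance.
Variables (T : finType) (e : rel T).

Definition walk (x y : T) (n : nat) : bool :=
  [exists p : n.-tuple T, path e x p && (last x p == y)].

Definition gdist (x y : T) : option nat :=
  match pselect (exists n, walk x y n) with
  | left ex_walk => Some (ex_minn ex_walk)
  | right _ => None
  end.

End GraphDistance.

Section PathAlgebra.
Variables (T : finType) (e : rel T).

Definition is_edge_path (s : seq T) : bool :=
  if s is x :: s' then path e x s' else false.

Definition edge_path := {s : seq T | is_edge_path s}.

Definition path_algebra := {malg int[edge_path]}.
HB.instance Definition _ := GRing.Zmodule.on path_algebra.

(* The basis element x_0...x_k attached to s = [:: x_0; ...; x_k], or 0 if s is
   not an edge path. *)
Definition pbasis (s : seq T) : path_algebra :=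
  if insub s is Some p then << (p : edge_path) >> else 0.

Definition pmul_basis (p q : edge_path) : path_algebra :=
  match val p, val q with
  | x :: s, y :: t => if last x s == y then pbasis (x :: s ++ t) else 0
  | _, _ => 0
  end.

Definition pmul (f g : path_algebra) : path_algebra :=
  \sum_(p <- msupp f) \sum_(q <- msupp g) pmul_basis p q *~ (f@_p * g@_q).

Definition pone : path_algebra := \sum_(x : T) pbasis [:: x].

Lemma pmulw (A B : {fset edge_path}) f g :
  {subset msupp f <= A} -> {subset msupp g <= B} ->
  pmul f g = \sum_(p <- A) \sum_(q <- B) pmul_basis p q *~ (f@_p * g@_q).
Proof.
move=> sA sB; rewrite /pmul.
transitivity (\sum_(p <- A) \sum_(q <- msupp g) pmul_basis p q *~ (f@_p * g@_q)).
  apply: big_fset_incl; first exact/fsubsetP.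
  by move=> p _ /mcoeff_outdom ->; apply: big1 => q _; rewrite mul0r mulr0z.
apply: eq_bigr => p _; apply: big_fset_incl; first exact/fsubsetP.
by move=> q _ /mcoeff_outdom ->; rewrite mulr0 mulr0z.
Qed.

Lemma pmulDl : left_distributive pmul +%R.
Proof.
move=> f f' g; pose A := (msupp f `|` msupp f' `|` msupp (f + f'))%fset.
rewrite !(@pmulw A (msupp g)) -?big_split //=; last 3 first.
- by move=> p hp; rewrite !inE hp orbT.
- by move=> p hp; rewrite !inE hp.
- by move=> p hp; rewrite !inE hp orbT.
apply: eq_bigr => p _; rewrite -big_split; apply: eq_bigr => q _ /=.
by rewrite mcoeffD mulrDl mulrzDr.
Qed.

Lemma pmulDr : right_distributive pmul +%R.
Proof.
move=> g f f'; pose A := (msupp f `|` msupp f' `|` msupp (f + f'))%fset.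
rewrite !(@pmulw (msupp g) A) -?big_split //=; last 3 first.
- by move=> p hp; rewrite !inE hp orbT.
- by move=> p hp; rewrite !inE hp.
- by move=> p hp; rewrite !inE hp orbT.
apply: eq_bigr => p _; rewrite -big_split; apply: eq_bigr => q _ /=.
by rewrite mcoeffD mulrDr mulrzDr.
Qed.

Lemma pmul0l g : pmul 0 g = 0.
Proof. by apply: (addrI (pmul 0 g)); rewrite -pmulDl !addr0. Qed.

Lemma pmul0r g : pmul g 0 = 0.
Proof. by apply: (addrI (pmul g 0)); rewrite -pmulDr !addr0. Qed.

Lemma pmulNl f g : pmul (- f) g = - pmul f g.
Proof. by apply/eqP; rewrite -addr_eq0 -pmulDl addNr pmul0l. Qed.

Lemma pmulNr f g : pmul g (- f) = - pmul g f.
Proof. by apply/eqP; rewrite -addr_eq0 -pmulDr addNr pmul0r. Qed.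

Lemma pmul_suml I r (P : pred I) F g :
  pmul (\sum_(i <- r | P i) F i) g = \sum_(i <- r | P i) pmul (F i) g.
Proof. by apply: (big_morph (pmul^~ g)) => [x y|]; rewrite ?pmulDl ?pmul0l. Qed.

Lemma pmul_sumr I r (P : pred I) F g :
  pmul g (\sum_(i <- r | P i) F i) = \sum_(i <- r | P i) pmul g (F i).
Proof. by apply: (big_morph (pmul g)) => [x y|]; rewrite ?pmulDr ?pmul0r. Qed.

Lemma pbasisE (p : edge_path) : pbasis (val p) = << p >>.
Proof. by rewrite /pbasis valK. Qed.

Lemma pbasis0 s : ~~ is_edge_path s -> pbasis s = 0.
Proof. by move=> sN; rewrite /pbasis insubN. Qed.

Lemma pmulUU (p q : edge_path) : pmul << p >> << q >> = pmul_basis p q.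
Proof.
rewrite (@pmulw [fset p] [fset q])%fset.
- by rewrite !big_seq_fset1 !mcoeffUU mulr1.
- by apply/fsubsetP; rewrite msuppU_le.
- by apply/fsubsetP; rewrite msuppU_le.
Qed.

Lemma pmulE x s y t :
  pmul (pbasis (x :: s)) (pbasis (y :: t)) =
  if last x s == y then pbasis (x :: s ++ t) else 0.
Proof.
have [xs|xsN] := boolP (is_edge_path (x :: s)); last first.
  rewrite pbasis0 // pmul0l; case: eqP => // _; rewrite pbasis0 //.
  by apply: contra xsN; rewrite /= cat_path => /andP[].
have [yt|ytN] := boolP (is_edge_path (y :: t)); last first.
  rewrite [pbasis (y :: t)]pbasis0 // pmul0r; case: eqP => // yE.
  rewrite pbasis0 //; apply: contra ytN; rewrite /= cat_path yE.
  by case/andP.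
by rewrite -[x :: s]/(val (exist is_edge_path _ xs : edge_path))
           -[y :: t]/(val (exist is_edge_path _ yt : edge_path)) !pbasisE pmulUU.
Qed.

Lemma path_algebra_ind (P : path_algebra -> Prop) :
  P 0 -> (forall f g, P f -> P g -> P (f + g)) -> (forall f, P f -> P (- f)) ->
  (forall x s, path e x s -> P (pbasis (x :: s))) -> forall f, P f.
Proof.
move=> P0 PD PN PU f; rewrite [f]monalgE; apply: big_ind => // p _.
have Pp : P << p >>.
  by case: p => [[|x s] // ps]; rewrite -pbasisE; apply: PU.
have -> : << f@_p *g p >> = << p >> *~ f@_p :> path_algebra.
  by rewrite -(raddfMz (mkmalgU p)) intz.
have Pn n : P (<< p >> *+ n).
  by elim: n => [|n IHn]; rewrite ?mulr0n // mulrS; apply: PD.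
by case: (f@_p) => n; [|apply: PN]; apply: Pn.
Qed.

Lemma pmulA : associative pmul.
Proof.
move=> f g h.
elim/path_algebra_ind: f => [|f f' IH IH'|f IH|x s _]; rewrite ?pmul0l //.
- by rewrite !pmulDl IH IH'.
- by rewrite !pmulNl IH.
elim/path_algebra_ind: g => [|g g' IH IH'|g IH|y t _].
- by rewrite !(pmul0l, pmul0r).
- by rewrite !(pmulDl, pmulDr) IH IH'.
- by rewrite !(pmulNl, pmulNr) IH.
elim/path_algebra_ind: h => [|h h' IH IH'|h IH|z u _]; rewrite ?pmul0r //.
- by rewrite !pmulDr IH IH'.
- by rewrite !pmulNr IH.
rewrite !pmulE; case: (eqVneq (last x s) y) => [<-|xyN].
- rewrite pmulE last_cat; case: (eqVneq (last _ t) z) => [_|]; last by rewrite pmul0r.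
  by rewrite pmulE eqxx catA.
- rewrite pmul0l; case: ifP => _; last by rewrite pmul0r.
  by rewrite pmulE (negPf xyN).
Qed.

Lemma pmul1 : left_id pone pmul.
Proof.
elim/path_algebra_ind => [|f f' IH IH'|f IH|x s _]; rewrite ?pmul0r //.
- by rewrite pmulDr IH IH'.
- by rewrite pmulNr IH.
rewrite /pone pmul_suml (bigD1 x) //= pmulE eqxx /= big1 ?addr0 // => y yx.
by rewrite pmulE /= (negPf yx).
Qed.

Lemma pmulr1 : right_id pone pmul.
Proof.
elim/path_algebra_ind => [|f f' IH IH'|f IH|x s _]; rewrite ?pmul0l //.
- by rewrite pmulDl IH IH'.
- by rewrite pmulNl IH.
rewrite /pone pmul_sumr (bigD1 (last x s)) //= pmulE eqxx /= cats0.
rewrite big1 ?addr0 // => y yx.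
by rewrite pmulE eq_sym (negPf yx).
Qed.

HB.instance Definition _ := GRing.Zmodule_isPzRing.Build path_algebra
  pmulA pmul1 pmulr1 pmulDl pmulDr.

Definition phomog (k : nat) (f : path_algebra) : Prop :=
  forall p : edge_path, p \in msupp f -> size (val p) = k.+1.

Definition relator (x z : T) : path_algebra :=
  \sum_(y | (gdist e x y == Some 1%N) && (gdist e y z == Some 1%N))
     pbasis [:: x; y; z].

Definition relators (r : path_algebra) : Prop :=
  exists x z : T, gdist e x z = Some 2%N /\ r = relator x z.

Definition path_quotient := quotring relators.
HB.instance Definition _ := GRing.PzRing.on path_quotient.

Definition path_quotient_homog (k : nat) (q : path_quotient) : Prop :=
  exists2 f : path_algebra, phomog k f & q = qproj relators f.

End PathAlgebra.

(* The metric axioms on d are not needed for the definitions below. The length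
   l is a natural number: for the metric of a graph, no simplex has any other
   finite length. *)
Section MagnitudeCochains.
Variables (T : finType) (d : T -> T -> option nat).

Definition slength (s : seq T) : option nat :=
  if s is x :: s' then foldr oadd (Some 0%N) (pairmap d x s') else Some 0%N.

Definition is_simplex (l : nat) (s : seq T) : bool :=
  sorted (fun x y => x != y) s && (slength s == Some l).

Definition simplex (k l : nat) := {t : k.+1.-tuple T | is_simplex l t}.

(* MC_{k,l}; int^o is int regarded as a module over itself *)
Definition chain (k l : nat) := {ffun simplex k l -> int^o}.

(* The basis element of MC_{k,l} attached to the tuple s, or 0 if s is not a
   k-simplex of length l. *)
Definition sbasis (k l : nat) (s : seq T) : chain k l :=
  [ffun x : simplex k l => (tval (val x) == s)%:R].

Definition linext k l (V : vectType int) (F : simplex k l -> V) :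
  'Hom(chain k l, V) := linfun (fun c : chain k l => \sum_x c x *: F x).

(* In the match, a, b, c are x_(i-1), x_i, x_(i+1). *)
Definition face (k l i : nat) (s : seq T) : chain k l :=
  if drop i.-1 s is [:: a, b, c & _] then
    if d a c == oadd (d a b) (d b c) then sbasis k l (take i s ++ drop i.+1 s)
    else 0
  else 0.

Definition bdry k l : 'Hom(chain k.+1 l, chain k l) :=
  linext (fun x : simplex k.+1 l =>
    \sum_(1 <= i < k.+1) (-1) ^+ i *: face k l i (val x)).

Definition cochain (k l : nat) := 'Hom(chain k l, int^o).

Definition cobdry k l (phi : cochain k l) : cochain k.+1 l :=
  (phi \o bdry k l)%VF.

(* The product of phi and psi, of bidegree (k1 + k2, l1 + l2). The bidegree
   (k, l) of the target is left free, to avoid casts along equalities of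
   bidegrees: cup phi psi vanishes unless k = k1 + k2 and l = l1 + l2 (lemma
   cup_eq0). As sbasis vanishes on tuples of the wrong length, the value of
   cup phi psi on x is 0 unless the two parts of x have lengths l1 and l2. *)
Definition cup k1 l1 k2 l2 k l (phi : cochain k1 l1) (psi : cochain k2 l2) :
    cochain k l :=
  linext (fun x : simplex k l =>
    phi (sbasis k1 l1 (take k1.+1 (val x))) *
    psi (sbasis k2 l2 (drop k1 (val x))) : int^o).

(* The unit, extended by 0 to bidegrees other than (0, 0). *)
Definition cunit k l : cochain k l :=
  linext (fun _ : simplex k l => ((k == 0%N) && (l == 0%N))%:R : int^o).

Lemma linextE k l (V : vectType int) (F : simplex k l -> V) c : linext F c = \sum_x c x *: F x.
Proof.
have lin : linear (fun c : chain k l => \sum_x c x *: F x).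
  move=> a u v; rewrite scaler_sumr -big_split; apply: eq_bigr => x _ /=.
  by rewrite !ffunE scalerA -scalerDl.
pose M := GRing.isLinear.Build int (chain k l) V *:%R _ lin.
pose f : {linear chain k l -> V} := HB.pack (fun c : chain k l => _) M.
exact: (lfunE f c).
Qed.

Lemma sbasis_val k l (x y : simplex k l) :
  sbasis k l (val x) y = (y == x)%:R.
Proof. by rewrite ffunE. Qed.

Lemma linext_val k l (V : vectType int) (F : simplex k l -> V) (x : simplex k l) :
  linext F (sbasis k l (val x)) = F x.
Proof.
rewrite linextE (bigD1 x) //= sbasis_val eqxx scale1r big1 ?addr0 // => y yx.
by rewrite sbasis_val (negPf yx) scale0r.
Qed.

Lemma chainE k l (c : chain k l) : c = \sum_x c x *: sbasis k l (val x).
Proof.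
apply/ffunP => y; rewrite sum_ffunE (bigD1 y) //= !ffunE eqxx.
rewrite big1 => [|x xy]; first by rewrite addr0 [RHS]mulr1.
rewrite !ffunE; have -> : (tval (val y) == val x :> seq T) = false.
  by apply/negP => /eqP yx; case/eqP: xy; do 2!apply: val_inj.
by rewrite scaler0.
Qed.

Definition simp k l s := (size s == k.+1) && is_simplex l s.

Lemma simp_val k l (x : simplex k l) : simp k l (val x).
Proof. by rewrite /simp size_tuple eqxx (valP x). Qed.

Lemma simpP k l s : simp k l s -> exists x : simplex k l, s = val x.
Proof.
case/andP => sz sl.
by exists (exist (fun t : k.+1.-tuple T => is_simplex l t) (Tuple sz) sl).
Qed.

Lemma sbasis0 k l s : ~~ simp k l s -> sbasis k l s = 0.
Proof.
move=> sN; apply/ffunP => x; rewrite !ffunE; case: eqP => // xs.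
by rewrite -xs simp_val in sN.
Qed.

Lemma cochainP k l (phi psi : cochain k l) :
  (forall s, simp k l s -> phi (sbasis k l s) = psi (sbasis k l s)) ->
  phi = psi.
Proof.
move=> eq_s; apply/lfunP => c; rewrite [c]chainE !linear_sum.
by apply: eq_bigr => x _; rewrite !linearZ /= eq_s //; apply: simp_val.
Qed.

Lemma ev_not_simp k l (phi : cochain k l) s :
  ~~ simp k l s -> phi (sbasis k l s) = 0.
Proof. by move=> /sbasis0 ->; rewrite linear0. Qed.

Lemma slength_cat s y t :
  slength (s ++ y :: t) = oadd (slength (rcons s y)) (slength (y :: t)).
Proof.
case: s => [|x s]; first by rewrite oadd0.
elim: s x => [|z s IH] x /=.
  by case: (d x y) => //= n; rewrite addn0.
by move: (IH z) => /= ->; rewrite oaddA.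
Qed.

Lemma slength_split k s : (k < size s)%N ->
  slength s = oadd (slength (take k.+1 s)) (slength (drop k s)).
Proof.
move=> ks; case: s ks => // x0 s ks; rewrite -{1}(cat_take_drop k (x0 :: s)).
by rewrite (drop_nth x0) // (take_nth x0) // slength_cat.
Qed.

Lemma sorted_split (r : rel T) k s : (k < size s)%N ->
  sorted r s = sorted r (take k.+1 s) && sorted r (drop k s).
Proof.
case: s => // x0 s ks; rewrite -{1}(cat_take_drop k (x0 :: s)).
rewrite (drop_nth x0) // (take_nth x0) //.
case: k ks => [|k] ks //=.
by rewrite cat_path rcons_path /= andbA.
Qed.

Lemma simp_split k1 l1 k2 l2 s :
  simp k1 l1 (take k1.+1 s) -> simp k2 l2 (drop k1 s) ->
  simp (k1 + k2) (l1 + l2) s.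
Proof.
case/andP => /eqP sz1 /andP[so1 /eqP le1] /andP[/eqP sz2 /andP[so2 /eqP le2]].
have szs : size s = (k1 + k2).+1.
  have h : (k1 < size s)%N by rewrite -(cat_take_drop k1.+1 s) size_cat sz1 leq_addr.
  by rewrite -addnS -sz2 size_drop subnKC // ltnW.
have ks : (k1 < size s)%N by rewrite szs ltnS leq_addr.
rewrite /simp szs eqxx /is_simplex (slength_split ks) (sorted_split _ ks).
by rewrite so1 so2 le1 le2 /=.
Qed.

Lemma cup_val k1 l1 k2 l2 k l phi psi s : simp k l s ->
  cup k l phi psi (sbasis k l s) =
  phi (sbasis k1 l1 (take k1.+1 s)) * psi (sbasis k2 l2 (drop k1 s)).
Proof. by case/simpP => x ->; rewrite linext_val. Qed.

Lemma cup_eq0 k1 l1 k2 l2 k l (phi : cochain k1 l1) (psi : cochain k2 l2) :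
  (k, l) != (k1 + k2, l1 + l2)%N -> cup k l phi psi = 0.
Proof.
move=> klN; apply: cochainP => s sims; rewrite cup_val // zero_lfunE.
have [s1|/ev_not_simp ->] := boolP (simp k1 l1 (take k1.+1 s)); last by rewrite mul0r.
have [s2|/ev_not_simp ->] := boolP (simp k2 l2 (drop k1 s)); last by rewrite mulr0.
case/negP: klN; apply/eqP.
case/andP: sims => /eqP szs /andP[_ /eqP ls].
case/andP: (simp_split s1 s2); rewrite szs eqSS => /eqP-> /andP[_].
by rewrite ls => /eqP[->].
Qed.

Lemma cup_ev k1 l1 k2 l2 (phi : cochain k1 l1) (psi : cochain k2 l2) s :
  cup (k1 + k2) (l1 + l2) phi psi (sbasis _ _ s) =
  phi (sbasis k1 l1 (take k1.+1 s)) * psi (sbasis k2 l2 (drop k1 s)).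
Proof.
have [?|sN] := boolP (simp (k1 + k2) (l1 + l2) s); first exact: cup_val.
rewrite ev_not_simp //.
have [s1|/ev_not_simp ->] := boolP (simp k1 l1 (take k1.+1 s)); last by rewrite mul0r.
have [s2|/ev_not_simp ->] := boolP (simp k2 l2 (drop k1 s)); last by rewrite mulr0.
by rewrite (simp_split s1 s2) in sN.
Qed.

Lemma cupDl k1 l1 k2 l2 k l (a b : cochain k1 l1) (c : cochain k2 l2) :
  cup k l (a + b) c = cup k l a c + cup k l b c.
Proof.
by apply: cochainP => s ss; rewrite add_lfunE !cup_val // add_lfunE mulrDl.
Qed.

Lemma cupDr k1 l1 k2 l2 k l (a b : cochain k1 l1) (c : cochain k2 l2) :
  cup k l c (a + b) = cup k l c a + cup k l c b.
Proof.
by apply: cochainP => s ss; rewrite add_lfunE !cup_val // add_lfunE mulrDr.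
Qed.

Lemma cup0l k1 l1 k2 l2 k l (c : cochain k2 l2) :
  cup k l (0 : cochain k1 l1) c = 0.
Proof. by apply: cochainP => s ss; rewrite cup_val // !zero_lfunE mul0r. Qed.

Lemma cup0r k1 l1 k2 l2 k l (c : cochain k2 l2) :
  cup k l c (0 : cochain k1 l1) = 0.
Proof. by apply: cochainP => s ss; rewrite cup_val // !zero_lfunE mulr0. Qed.

Lemma cupNl k1 l1 k2 l2 k l (a : cochain k1 l1) (c : cochain k2 l2) :
  cup k l (- a) c = - cup k l a c.
Proof.
by apply: cochainP => s ss; rewrite opp_lfunE !cup_val // opp_lfunE mulNr.
Qed.

Lemma cupNr k1 l1 k2 l2 k l (a : cochain k1 l1) (c : cochain k2 l2) :
  cup k l c (- a) = - cup k l c a.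
Proof.
by apply: cochainP => s ss; rewrite opp_lfunE !cup_val // opp_lfunE mulrN.
Qed.

Lemma cupA k1 l1 k2 l2 k3 l3 k l
    (a : cochain k1 l1) (b : cochain k2 l2) (c : cochain k3 l3) :
  cup k l a (cup (k2 + k3) (l2 + l3) b c) =
  cup k l (cup (k1 + k2) (l1 + l2) a b) c.
Proof.
apply: cochainP => s ss; rewrite !(@cup_val _ _ _ _ _ _ _ _ s ss) !cup_ev mulrA.
have E1 : take k1.+1 (take (k1 + k2).+1 s) = take k1.+1 s.
  by rewrite take_takel // ltnS leq_addr.
have E2 : drop k1 (take (k1 + k2).+1 s) = take k2.+1 (drop k1 s).
  by rewrite take_drop addSn addnC.
have E3 : drop k2 (drop k1 s) = drop (k1 + k2) s by rewrite drop_drop addnC.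
by rewrite E1 E2 E3.
Qed.

Lemma cup1l k2 l2 (a : cochain k2 l2) : cup k2 l2 (cunit 0 0) a = a.
Proof.
apply: cochainP => s ss; rewrite cup_val // drop0.
have s1 : simp 0 0 (take 1 s) by case: s ss => [//|x s] _; rewrite /= take0.
by have [x ->] := simpP s1; rewrite linext_val mul1r.
Qed.

Lemma cup1r k1 l1 (a : cochain k1 l1) : cup k1 l1 a (cunit 0 0) = a.
Proof.
apply: cochainP => s ss; rewrite cup_val //.
case/andP: (ss) => /eqP sz _.
have s1 : simp 0 0 (drop k1 s).
  have : size (drop k1 s) = 1%N by rewrite size_drop sz subSnn.
  by case: (drop k1 s) => [|x []].
by have [x ->] := simpP s1; rewrite linext_val mulr1 take_oversize ?sz.
Qed.

Definition cobdry_seq k l (phi : cochain k l) (s : seq T) : int :=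
  \sum_(1 <= i < k.+1) (-1) ^+ i * phi (face k l i s).

Lemma faceE k l i (u r : seq T) a b c : size u = i ->
  face k l i.+1 (u ++ [:: a, b, c & r]) =
  if d a c == oadd (d a b) (d b c) then sbasis k l (u ++ [:: a, c & r]) else 0.
Proof.
move=> szu; rewrite /face /= drop_size_cat //.
have -> : take i.+1 (u ++ [:: a, b, c & r]) = rcons u a.
  by rewrite -cat_rcons take_size_cat // size_rcons szu.
have -> : drop i.+2 (u ++ [:: a, b, c & r]) = c :: r.
  by rewrite -[_ ++ _]/(u ++ [:: a; b] ++ c :: r) catA drop_size_cat // size_cat szu addn2.
by rewrite cat_rcons.
Qed.

Lemma face_split i (s : seq T) : (i.+2 < size s)%N ->
  exists u a b c r, size u = i /\ s = u ++ [:: a, b, c & r].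
Proof.
move=> is2; have szd := size_drop i s.
have szu : size (take i s) = i by rewrite size_takel //; lia.
have := cat_take_drop i s.
case: (drop i s) szd => [|a [|b [|c r]]] /= szd sE; try lia.
by exists (take i s), a, b, c, r.
Qed.

Lemma face_not_simp k l i s :
  (0 < i < k.+1)%N -> size s = k.+2 -> sorted (fun x y => x != y) s ->
  slength s != Some l -> face k l i s = 0.
Proof.
case: i => // i ik sz so lN.
have [|u [a [b [c [r [szu sE]]]]]] := @face_split i s; first by rewrite sz; lia.
rewrite sE faceE //.
case: eqP => // dE; apply: sbasis0; apply: contra lN => /andP[_ /andP[_]].
by rewrite sE 2!slength_cat /= dE -!oaddA.
Qed.

Lemma cobdry_ev k l (phi : cochain k l) s :
  size s = k.+2 -> sorted (fun x y => x != y) s ->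
  cobdry phi (sbasis _ _ s) = cobdry_seq phi s.
Proof.
move=> sz so; rewrite comp_lfunE.
have [ss|sN] := boolP (simp k.+1 l s).
  have [x ->] := simpP ss; rewrite linext_val linear_sum.
  by apply: eq_bigr => i _; rewrite linearZ.
rewrite sbasis0 // !linear0 /cobdry_seq big_nat big1 // => i ik.
rewrite face_not_simp ?linear0 ?mulr0 //.
by apply: contra sN; rewrite /simp sz eqxx /is_simplex so.
Qed.

Lemma cobdry_seq0 k l (phi : cochain k l) s :
  size s = k.+2 -> sorted (fun x y => x != y) s ->
  cobdry phi = 0 -> cobdry_seq phi s = 0.
Proof. by move=> sz so phi0; rewrite -cobdry_ev // phi0 zero_lfunE. Qed.

Lemma sum_shift (F : nat -> int) a b :
  \sum_(a.+1 <= i < (a + b).+1) F i = \sum_(1 <= i < b.+1) F (i + a)%N.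
Proof. by rewrite -add1n big_addn -addnS addKn. Qed.

Lemma mul_signs (a b : int^o) i k :
  (-1) ^+ (i + k) * (a * b) = (-1 : int) ^+ k *: (a * ((-1) ^+ i * b)) :> int^o.
Proof.
rewrite -[RHS]/((-1) ^+ k * (a * ((-1) ^+ i * b))).
by rewrite exprD [_ * (-1) ^+ k]mulrC -mulrA; congr (_ * _); rewrite mulrCA.
Qed.

Lemma leibniz k1 l1 k2 l2 k l (phi : cochain k1 l1) (psi : cochain k2 l2) :
  cobdry (cup k l phi psi) =
  cup k.+1 l (cobdry phi) psi + (-1) ^+ k1 *: cup k.+1 l phi (cobdry psi).
Proof.
have [[-> ->]|klN] := eqVneq (k, l) (k1 + k2, l1 + l2)%N; last first.
  rewrite !cup_eq0 ?scaler0 ?addr0 ?addnS ?addSn; last 3 first.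
  - by apply: contra klN => /eqP[-> ->].
  - by apply: contra klN => /eqP[-> ->].
  - by [].
  by apply: cochainP => s _; rewrite comp_lfunE !zero_lfunE.
apply: cochainP => s ss; rewrite add_lfunE scale_lfunE !cup_val //.
case/andP: (ss) => /eqP sz /andP[so _].
rewrite cobdry_ev //.
have k1s : (k1 < size s)%N by rewrite sz; lia.
have k1s' : (k1.+1 < size s)%N by rewrite sz; lia.
have so2 : sorted (fun x y => x != y) (drop k1 s).
  by move: so; rewrite (sorted_split _ k1s) => /andP[].
have so1 : sorted (fun x y => x != y) (take k1.+2 s).
  by move: so; rewrite (sorted_split _ k1s') => /andP[].
rewrite !cobdry_ev //; last 2 first.
- by rewrite size_drop sz; lia.
- by rewrite size_take sz; case: ifP; lia.
rewrite /cobdry_seq (@big_cat_nat _ _ _ k1.+1) //=; try lia.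
congr (_ + _).
  rewrite mulr_suml; apply: eq_big_nat => -[|i] // ik.
  rewrite -mulrA; congr (_ * _).
  have [|u [a [b [c [r [szu sE]]]]]] := @face_split i s; first by lia.
  pose m := (k1 - i.+1)%N.
  have -> : take k1.+2 s = u ++ [:: a, b, c & take m r].
    have -> : k1.+2 = (size u + m.+3)%N by lia.
    by rewrite sE takeD take_size_cat // drop_size_cat.
  have -> : drop k1.+1 s = drop m (c :: r).
    have -> : k1.+1 = (m.+2 + size u)%N by lia.
    by rewrite sE -drop_drop drop_size_cat.
  rewrite sE !faceE //; case: ifP => _; last by rewrite !linear0 mul0r.
  rewrite cup_ev; congr (phi (sbasis _ _ _) * psi (sbasis _ _ _)).
    have -> : k1.+1 = (size u + m.+2)%N by lia.
    by rewrite takeD take_size_cat // drop_size_cat.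
  have -> : k1 = (m.+1 + size u)%N by lia.
  by rewrite -drop_drop drop_size_cat.
rewrite sum_shift mulr_sumr scaler_sumr; apply: eq_big_nat => -[|i] // ik.
rewrite -mul_signs; congr (_ * _).
have [|u [a [b [c [r [szu sE]]]]]] := @face_split (k1 + i) s; first by lia.
have -> : take k1.+1 s = take k1.+1 (rcons u a).
  by rewrite sE -cat_rcons takel_cat // size_rcons szu; lia.
have -> : drop k1 s = drop k1 u ++ [:: a, b, c & r].
  rewrite sE drop_cat; case: ltngtP => // h; [lia|].
  by rewrite h subnn drop0 drop_oversize ?h.
have szd : size (drop k1 u) = i by rewrite size_drop szu; lia.
rewrite addSn [(i + k1)%N]addnC sE !faceE //.
case: ifP => _; last by rewrite !linear0 mulr0.
rewrite cup_ev; congr (phi (sbasis _ _ _) * psi (sbasis _ _ _)).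
  by rewrite -cat_rcons takel_cat // size_rcons szu; lia.
rewrite drop_cat; case: ltngtP => // h; [lia|].
by rewrite h subnn drop0 drop_oversize ?h.
Qed.

Definition is_cocycle k l : {pred cochain k l} :=
  fun phi => cobdry phi == 0.

Lemma is_cocycle_zmod_closed k l : zmod_closed (@is_cocycle k l).
Proof.
split=> [|x y]; rewrite !unfold_in /cobdry ?comp_lfun0l // => /eqP x0 /eqP y0.
by rewrite comp_lfunDl comp_lfunNl x0 y0 subrr.
Qed.

HB.instance Definition _ k l :=
  GRing.isZmodClosed.Build _ (@is_cocycle k l) (@is_cocycle_zmod_closed k l).

Record cocycle k l := Cocycle {
  cocycle_val :> cochain k l;
  _ : cocycle_val \in @is_cocycle k l }.

HB.instance Definition _ k l := [isSub for @cocycle_val k l].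
HB.instance Definition _ k l := [Choice of cocycle k l by <:].
HB.instance Definition _ k l := [SubChoice_isSubZmodule of cocycle k l by <:].

Lemma cocycle_cobdry k l (z : cocycle k l) : cobdry z = 0.
Proof. by apply/eqP; exact: (valP z). Qed.

(* MC^{-1} is 0. *)
Definition cobdry_image k l : cochain k l -> Prop :=
  match k with
  | 0 => fun phi => phi = 0
  | k'.+1 => fun phi => exists psi : cochain k' l, phi = cobdry psi
  end.

Definition coboundary k l : {pred cocycle k l} :=
  fun z => `[< @cobdry_image k l (val z) >].

Lemma cobdry_image0 k l : @cobdry_image k l 0.
Proof. by case: k => [|k] //=; exists 0; rewrite /cobdry comp_lfun0l. Qed.

Lemma cobdry_imageD k l phi psi : @cobdry_image k l phi ->
  @cobdry_image k l psi -> @cobdry_image k l (phi + psi).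
Proof.
case: k phi psi => [|k] phi psi /=; first by move=> -> ->; rewrite addr0.
by move=> [a ->] [b ->]; exists (a + b); rewrite /cobdry comp_lfunDl.
Qed.

Lemma cobdry_imageN k l phi :
  @cobdry_image k l phi -> @cobdry_image k l (- phi).
Proof.
case: k phi => [|k] phi /=; first by move=> ->; rewrite oppr0.
by move=> [a ->]; exists (- a); rewrite /cobdry comp_lfunNl.
Qed.

Lemma coboundaryP k l z : reflect (@cobdry_image k l (val z)) (z \in @coboundary k l).
Proof. exact: asboolP. Qed.

Lemma coboundary_zmod_closed k l : zmod_closed (@coboundary k l).
Proof.
split=> [|x y /coboundaryP x0 /coboundaryP y0]; apply/coboundaryP.
  exact: cobdry_image0.
by rewrite raddfB; apply: cobdry_imageD => //; apply: cobdry_imageN.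
Qed.

HB.instance Definition _ k l :=
  GRing.isZmodClosed.Build _ (@coboundary k l) (@coboundary_zmod_closed k l).

Definition MH (k l : nat) := Quotient.quot (@coboundary k l).
HB.instance Definition _ k l := GRing.Zmodule.on (MH k l).

Definition mhclass k l (z : cocycle k l) : MH k l :=
  \pi_(Quotient.quot (@coboundary k l))%qT z.

Lemma cup_cocycle k1 l1 k2 l2 k l (z : cocycle k1 l1) (w : cocycle k2 l2) :
  cup k l (val z) (val w) \in @is_cocycle k l.
Proof.
by rewrite unfold_in leibniz !cocycle_cobdry cup0l cup0r scaler0 addr0.
Qed.

Definition cup_cocycles k1 l1 k2 l2 k l
    (z : cocycle k1 l1) (w : cocycle k2 l2) : cocycle k l :=
  Cocycle (cup_cocycle k l z w).

Definition mhcup k1 l1 k2 l2 k l (a : MH k1 l1) (b : MH k2 l2) : MH k l :=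
  mhclass (cup_cocycles k l (repr a) (repr b)).

Lemma cunit_cocycle k l : cunit k l \in @is_cocycle k l.
Proof.
rewrite unfold_in; apply/eqP; apply: cochainP => s ss.
case/andP: (ss) => /eqP sz /andP[so _]; rewrite cobdry_ev // zero_lfunE.
case: k ss sz => [|k] ss sz; first by rewrite /cobdry_seq big_geq.
rewrite /cobdry_seq big1 // => i _; rewrite linextE big1 ?mulr0 // => x _.
by rewrite scaler0.
Qed.

Definition mhunit k l : MH k l := mhclass (Cocycle (cunit_cocycle k l)).

Lemma mhclass_surj k l (a : MH k l) : exists z, a = mhclass z.
Proof. by exists (repr a); rewrite /mhclass reprK. Qed.

Lemma mhclass_eq k l (z w : cocycle k l) :
  mhclass z = mhclass w <-> cobdry_image (val z - val w).
Proof.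
rewrite -raddfB; split => [/eqP|] h; last apply/eqP.
  by apply/coboundaryP; rewrite Quotient.idealrBE.
by move/coboundaryP: h; rewrite Quotient.idealrBE.
Qed.

Lemma mhclassD k l (z w : cocycle k l) :
  mhclass (z + w) = mhclass z + mhclass w.
Proof. exact: (@pi_addr _ _ _ _ _ (Quotient.quot (@coboundary k l))). Qed.

Lemma mhclass0 k l : mhclass (0 : cocycle k l) = 0.
Proof. by apply: (addrI (mhclass 0)); rewrite -mhclassD !addr0. Qed.

Lemma cup_cobdryl k1 l1 k2 l2 k l (phi : cochain k1 l1) (w : cocycle k2 l2) :
  cobdry_image phi -> @cobdry_image k l (cup k l phi (val w)).
Proof.
have [[-> ->]|klN] := eqVneq (k, l) (k1 + k2, l1 + l2)%N; last first.
  by move=> _; rewrite cup_eq0 //; apply: cobdry_image0.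
case: k1 phi => [|k1] phi /=; first by move=> ->; rewrite cup0l; apply: cobdry_image0.
case=> psi ->; exists (cup _ _ psi (val w)).
by rewrite leibniz cocycle_cobdry cup0r scaler0 addr0.
Qed.

Lemma cup_cobdryr k1 l1 k2 l2 k l (z : cocycle k1 l1) (phi : cochain k2 l2) :
  cobdry_image phi -> @cobdry_image k l (cup k l (val z) phi).
Proof.
case: k2 phi => [|k2] phi /=; first by move=> ->; rewrite cup0r; apply: cobdry_image0.
case=> psi ->; case: k => [|k].
  by rewrite cup_eq0 ?addnS //; apply: cobdry_image0.
exists (cup k l (val z) ((-1) ^+ k1 *: psi)).
rewrite leibniz cocycle_cobdry cup0l add0r.
apply: cochainP => s ss; rewrite scale_lfunE !cup_val // !comp_lfunE scale_lfunE.
by rewrite [X in _ = _ *: X]mulrC -scalerAl scalerA -signr_odd -expr2 sqrr_sign scale1r mulrC.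
Qed.

Lemma mhcup_class k1 l1 k2 l2 k l (z : cocycle k1 l1) (w : cocycle k2 l2) :
  mhcup k l (mhclass z) (mhclass w) = mhclass (cup_cocycles k l z w).
Proof.
have rE k' l' (x : cocycle k' l') : cobdry_image (val (repr (mhclass x)) - val x).
  by apply/mhclass_eq; rewrite [LHS]reprK.
apply/mhclass_eq => /=.
set z' := repr _; set w' := repr _.
have -> : cup k l (val z') (val w') - cup k l (val z) (val w) =
  cup k l (val z' - val z) (val w') + cup k l (val z) (val w' - val w).
  by rewrite cupDl cupDr cupNl cupNr addrA subrK.
by apply: cobdry_imageD; [apply: cup_cobdryl; apply: rE|apply: cup_cobdryr; apply: rE].
Qed.

Lemma mhclass_inj_val k l (z w : cocycle k l) :
  val z = val w -> mhclass z = mhclass w.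
Proof. by move/val_inj->. Qed.

Lemma mhcupDl k1 l1 k2 l2 k l (a b : MH k1 l1) (c : MH k2 l2) :
  mhcup k l (a + b) c = mhcup k l a c + mhcup k l b c.
Proof.
have [x ->] := mhclass_surj a; have [y ->] := mhclass_surj b.
have [z ->] := mhclass_surj c; rewrite -mhclassD !mhcup_class -mhclassD.
by apply: mhclass_inj_val; rewrite /= cupDl.
Qed.

Lemma mhcupDr k1 l1 k2 l2 k l (a b : MH k1 l1) (c : MH k2 l2) :
  mhcup k l c (a + b) = mhcup k l c a + mhcup k l c b.
Proof.
have [x ->] := mhclass_surj a; have [y ->] := mhclass_surj b.
have [z ->] := mhclass_surj c; rewrite -mhclassD !mhcup_class -mhclassD.
by apply: mhclass_inj_val; rewrite /= cupDr.
Qed.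

Lemma mhcup0l k1 l1 k2 l2 k l (c : MH k2 l2) : mhcup k l (0 : MH k1 l1) c = 0.
Proof.
have [z ->] := mhclass_surj c; rewrite -!mhclass0 mhcup_class.
by apply: mhclass_inj_val; rewrite /= cup0l.
Qed.

Lemma mhcup0r k1 l1 k2 l2 k l (c : MH k2 l2) : mhcup k l c (0 : MH k1 l1) = 0.
Proof.
have [z ->] := mhclass_surj c; rewrite -!mhclass0 mhcup_class.
by apply: mhclass_inj_val; rewrite /= cup0r.
Qed.

Lemma mhcup_eq0 k1 l1 k2 l2 k l (a : MH k1 l1) (b : MH k2 l2) :
  (k, l) != (k1 + k2, l1 + l2)%N -> mhcup k l a b = 0.
Proof.
move=> klN; have [x ->] := mhclass_surj a; have [y ->] := mhclass_surj b.
rewrite mhcup_class -mhclass0; apply: mhclass_inj_val => /=.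
by rewrite cup_eq0.
Qed.

Lemma mhcupA k1 l1 k2 l2 k3 l3 k l
    (a : MH k1 l1) (b : MH k2 l2) (c : MH k3 l3) :
  mhcup k l a (mhcup (k2 + k3) (l2 + l3) b c) =
  mhcup k l (mhcup (k1 + k2) (l1 + l2) a b) c.
Proof.
have [x ->] := mhclass_surj a; have [y ->] := mhclass_surj b.
have [z ->] := mhclass_surj c; rewrite !mhcup_class.
by apply: mhclass_inj_val; rewrite /= cupA.
Qed.

Lemma mhcup1l k l (a : MH k l) : mhcup k l (mhunit 0 0) a = a.
Proof.
have [x ->] := mhclass_surj a; rewrite mhcup_class.
by apply: mhclass_inj_val; rewrite /= cup1l.
Qed.

Lemma mhcup1r k l (a : MH k l) : mhcup k l a (mhunit 0 0) = a.
Proof.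
have [x ->] := mhclass_surj a; rewrite mhcup_class.
by apply: mhclass_inj_val; rewrite /= cup1r.
Qed.

Lemma mhunit_eq0 k l : (k, l) != (0, 0)%N -> mhunit k l = 0.
Proof.
rewrite xpair_eqE => klN; rewrite -mhclass0; apply: mhclass_inj_val => /=.
by apply: cochainP => s /simpP[x ->]; rewrite linext_val (negPf klN) zero_lfunE.
Qed.

End MagnitudeCochains.

Section MagnitudeRing.
Variables (T : finType) (d : T -> T -> option nat).

(* The direct sum of the groups MH^k_l: families with finite support. *)
Record mhring := MHRing {
  mhcomp :> forall k l, MH d k l;
  mhcomp_finite : exists N, forall k l,
    (N <= k)%N || (N <= l)%N -> mhcomp k l = 0 }.

HB.instance Definition _ := gen_eqMixin mhring.
HB.instance Definition _ := gen_choiceMixin mhring.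

Lemma mhringP (x y : mhring) : (forall k l, x k l = y k l) -> x = y.
Proof.
case: x y => [x xP] [y yP] /= xy.
have {}xy : x = y by do 2!(apply: functional_extensionality_dep => ?).
by rewrite xy in xP *; rewrite (Prop_irrelevance xP yP).
Qed.

Fact mhzero_finite : exists N, forall k l,
  (N <= k)%N || (N <= l)%N -> (0 : MH d k l) = 0.
Proof. by exists 0%N. Qed.
Definition mhzero := MHRing mhzero_finite.

Fact mhadd_finite (x y : mhring) : exists N, forall k l,
  (N <= k)%N || (N <= l)%N -> x k l + y k l = 0.
Proof.
case: x y => x [N xN] [y [M yM]] /=; exists (N + M)%N => k l kl.
by rewrite xN ?yM ?addr0 //; lia.
Qed.
Definition mhadd x y := MHRing (mhadd_finite x y).

Fact mhopp_finite (x : mhring) : exists N, forall k l,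
  (N <= k)%N || (N <= l)%N -> - x k l = 0.
Proof. by case: x => x [N xN] /=; exists N => k l /xN ->; rewrite oppr0. Qed.
Definition mhopp x := MHRing (mhopp_finite x).

Lemma mhaddA : associative mhadd.
Proof. by move=> x y z; apply: mhringP => k l /=; rewrite addrA. Qed.
Lemma mhaddC : commutative mhadd.
Proof. by move=> x y; apply: mhringP => k l /=; rewrite addrC. Qed.
Lemma mhadd0 : left_id mhzero mhadd.
Proof. by move=> x; apply: mhringP => k l /=; rewrite add0r. Qed.
Lemma mhaddN : left_inverse mhzero mhopp mhadd.
Proof. by move=> x; apply: mhringP => k l /=; rewrite addNr. Qed.

HB.instance Definition _ :=
  GRing.isZmodule.Build mhring mhaddA mhaddC mhadd0 mhaddN.

Lemma mhring0E k l : (0 : mhring) k l = 0. Proof. by []. Qed.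
Lemma mhringDE (x y : mhring) k l : (x + y) k l = x k l + y k l.
Proof. by []. Qed.
Lemma mhringNE (x : mhring) k l : (- x) k l = - x k l.
Proof. by []. Qed.

Definition mhmul_comp (x y : mhring) k l : MH d k l :=
  \sum_(k1 < k.+1) \sum_(l1 < l.+1)
     mhcup k l (x k1 l1) (y (k - k1)%N (l - l1)%N).

Fact mhmul_finite (x y : mhring) : exists N, forall k l,
  (N <= k)%N || (N <= l)%N -> mhmul_comp x y k l = 0.
Proof.
have [N xN] := mhcomp_finite x; have [M yM] := mhcomp_finite y.
exists (N + M)%N => k l kl; rewrite /mhmul_comp.
rewrite big1 // => k1 _; rewrite big1 // => l1 _.
have [h|h] := boolP ((N <= k1)%N || (N <= l1)%N).
  by rewrite xN // mhcup0l.
by rewrite yM ?mhcup0r //; lia.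
Qed.
Definition mhmul x y := MHRing (mhmul_finite x y).

Fact mhone_finite : exists N, forall k l,
  (N <= k)%N || (N <= l)%N -> mhunit d k l = 0.
Proof. by exists 1%N => k l kl; rewrite mhunit_eq0 // xpair_eqE; lia. Qed.
Definition mhone := MHRing mhone_finite.

Lemma mhcup_suml k1 l1 k2 l2 k l I r (P : pred I) (F : I -> MH d k1 l1)
    (c : MH d k2 l2) :
  mhcup k l (\sum_(i <- r | P i) F i) c = \sum_(i <- r | P i) mhcup k l (F i) c.
Proof.
by apply: (big_morph (fun a => mhcup k l a c)) => [x y|];
  [apply: mhcupDl|apply: mhcup0l].
Qed.

Lemma mhcup_sumr k1 l1 k2 l2 k l I r (P : pred I) (F : I -> MH d k1 l1)
    (c : MH d k2 l2) :
  mhcup k l c (\sum_(i <- r | P i) F i) = \sum_(i <- r | P i) mhcup k l c (F i).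
Proof.
by apply: (big_morph (fun a => mhcup k l c a)) => [x y|];
  [apply: mhcupDr|apply: mhcup0r].
Qed.

Lemma mhmulE N (x y : mhring) k l : (k < N)%N -> (l < N)%N ->
  mhmul x y k l = \sum_(p : 'I_N * 'I_N) \sum_(q : 'I_N * 'I_N)
    mhcup k l (x p.1 p.2) (y q.1 q.2).
Proof.
move=> kN lN; rewrite /= /mhmul_comp.
transitivity (\sum_(k1 < k.+1) \sum_(l1 < N | (l1 < l.+1)%N)
    mhcup k l (x k1 l1) (y (k - k1)%N (l - l1)%N)).
  apply: eq_bigr => k1 _.
  exact: (big_ord_widen N (fun l1 =>
    mhcup k l (x k1 l1) (y (k - k1)%N (l - l1)%N))).
rewrite (big_ord_widen N (fun k1 => \sum_(l1 < N | (l1 < l.+1)%N)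
  mhcup k l (x k1 l1) (y (k - k1)%N (l - l1)%N))) //.
rewrite pair_big_dep /= big_mkcond; apply: eq_bigr => -[k1 l1] _ /=.
case: ifP => [/andP[kk ll]|klN].
  have kk' : (k - k1 < N)%N by lia.
  have ll' : (l - l1 < N)%N by lia.
  rewrite (bigD1 (Ordinal kk', Ordinal ll')) //= big1 ?addr0 // => -[a b] abN /=.
  apply: mhcup_eq0; apply: contra abN; rewrite !xpair_eqE -!val_eqE /=.
  by case/andP; lia.
rewrite big1 // => -[a b] _ /=.
apply: mhcup_eq0; apply: contraFN klN; rewrite xpair_eqE.
by case/andP; lia.
Qed.

Lemma mhcup_collapser N k l k1 l1 k2 l2 k3 l3
  (a : MH d k1 l1) (b : MH d k2 l2) (c : MH d k3 l3) :
  (k < N)%N -> (l < N)%N ->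
  \sum_(p : 'I_N * 'I_N) mhcup k l a (mhcup p.1 p.2 b c) =
  mhcup k l a (mhcup (k2 + k3) (l2 + l3) b c).
Proof.
move=> kN lN.
have [/andP[kk ll]|klN] := boolP ((k2 + k3 < N) && (l2 + l3 < N))%N.
  rewrite (bigD1 (Ordinal kk, Ordinal ll)) //= big1 ?addr0 // => -[u v] uvN /=.
  rewrite [mhcup u v b c]mhcup_eq0 ?mhcup0r //.
rewrite [RHS]mhcup_eq0 ?xpair_eqE; last by lia.
rewrite big1 // => -[u v] _ /=.
rewrite [mhcup u v b c]mhcup_eq0 ?mhcup0r // xpair_eqE.
by have := ltn_ord u; have := ltn_ord v; lia.
Qed.

Lemma mhcup_collapsel N k l k1 l1 k2 l2 k3 l3
  (a : MH d k1 l1) (b : MH d k2 l2) (c : MH d k3 l3) :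
  (k < N)%N -> (l < N)%N ->
  \sum_(p : 'I_N * 'I_N) mhcup k l (mhcup p.1 p.2 a b) c =
  mhcup k l (mhcup (k1 + k2) (l1 + l2) a b) c.
Proof.
move=> kN lN.
have [/andP[kk ll]|klN] := boolP ((k1 + k2 < N) && (l1 + l2 < N))%N.
  rewrite (bigD1 (Ordinal kk, Ordinal ll)) //= big1 ?addr0 // => -[u v] uvN /=.
  rewrite [mhcup u v a b]mhcup_eq0 ?mhcup0l //.
rewrite [RHS]mhcup_eq0 ?xpair_eqE; last by lia.
rewrite big1 // => -[u v] _ /=.
rewrite [mhcup u v a b]mhcup_eq0 ?mhcup0l // xpair_eqE.
by have := ltn_ord u; have := ltn_ord v; lia.
Qed.

Lemma mhmulA : associative mhmul.
Proof.
move=> x y z; apply: mhringP => k l.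
pose N := (k + l).+1; have kN : (k < N)%N by rewrite /N; lia.
have lN : (l < N)%N by rewrite /N; lia.
rewrite !(@mhmulE N) //.
transitivity (\sum_(p : 'I_N * 'I_N) \sum_(q : 'I_N * 'I_N)
  \sum_(r : 'I_N * 'I_N) mhcup k l (x p.1 p.2)
     (mhcup (q.1 + r.1) (q.2 + r.2) (y q.1 q.2) (z r.1 r.2))).
  apply: eq_bigr => p _.
  under eq_bigr => m _ do rewrite (mhmulE y z (ltn_ord m.1) (ltn_ord m.2))
    mhcup_sumr.
  rewrite exchange_big; apply: eq_bigr => q _.
  under eq_bigr => m _ do rewrite mhcup_sumr.
  rewrite exchange_big; apply: eq_bigr => r _.
  exact: mhcup_collapser.
rewrite [RHS]exchange_big.
transitivity (\sum_(r : 'I_N * 'I_N) \sum_(p : 'I_N * 'I_N)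
  \sum_(q : 'I_N * 'I_N) mhcup k l (x p.1 p.2)
     (mhcup (q.1 + r.1) (q.2 + r.2) (y q.1 q.2) (z r.1 r.2))).
  under eq_bigr => p _ do rewrite exchange_big.
  by rewrite exchange_big.
apply: eq_bigr => r _; symmetry.
under eq_bigr => m _ do rewrite (mhmulE x y (ltn_ord m.1) (ltn_ord m.2))
  mhcup_suml.
rewrite exchange_big; apply: eq_bigr => p _.
under eq_bigr => m _ do rewrite mhcup_suml.
rewrite exchange_big; apply: eq_bigr => q _.
by rewrite mhcup_collapsel // -mhcupA.
Qed.

Lemma mhmul1 : left_id mhone mhmul.
Proof.
move=> x; apply: mhringP => k l.
pose N := (k + l).+1; have kN : (k < N)%N by rewrite /N; lia.
have lN : (l < N)%N by rewrite /N; lia.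
rewrite (@mhmulE N) // (bigD1 (ord0, ord0)) //= [X in _ + X]big1 ?addr0; last first.
  move=> [a b] abN; apply: big1 => q _ /=.
  by rewrite mhunit_eq0 ?mhcup0l //; apply: contra abN; rewrite !xpair_eqE -!val_eqE.
rewrite (bigD1 (Ordinal kN, Ordinal lN)) //= mhcup1l big1 ?addr0 // => -[a b] abN /=.
by apply: mhcup_eq0; apply: contra abN; rewrite !xpair_eqE -!val_eqE /=; lia.
Qed.

Lemma mhmulr1 : right_id mhone mhmul.
Proof.
move=> x; apply: mhringP => k l.
pose N := (k + l).+1; have kN : (k < N)%N by rewrite /N; lia.
have lN : (l < N)%N by rewrite /N; lia.
rewrite (@mhmulE N) // exchange_big (bigD1 (ord0, ord0)) //=.
rewrite [X in _ + X]big1 ?addr0; last first.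
  move=> [a b] abN; apply: big1 => q _ /=.
  by rewrite mhunit_eq0 ?mhcup0r //; apply: contra abN; rewrite !xpair_eqE -!val_eqE.
rewrite (bigD1 (Ordinal kN, Ordinal lN)) //= mhcup1r big1 ?addr0 // => -[a b] abN /=.
by apply: mhcup_eq0; apply: contra abN; rewrite !xpair_eqE -!val_eqE /=; lia.
Qed.

Lemma mhmulDl : left_distributive mhmul +%R.
Proof.
move=> x y z; apply: mhringP => k l; rewrite mhringDE /= /mhmul_comp.
rewrite -big_split; apply: eq_bigr => k1 _; rewrite -big_split.
by apply: eq_bigr => l1 _ /=; rewrite mhcupDl.
Qed.

Lemma mhmulDr : right_distributive mhmul +%R.
Proof.
move=> x y z; apply: mhringP => k l; rewrite mhringDE /= /mhmul_comp.
rewrite -big_split; apply: eq_bigr => k1 _; rewrite -big_split.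
by apply: eq_bigr => l1 _ /=; rewrite mhcupDr.
Qed.

HB.instance Definition _ := GRing.Zmodule_isPzRing.Build mhring
  mhmulA mhmul1 mhmulr1 mhmulDl mhmulDr.

Definition is_diagonal : {pred mhring} :=
  fun x => `[< forall k l, k <> l -> x k l = 0 >].

Lemma is_diagonalP (x : mhring) :
  reflect (forall k l, k <> l -> x k l = 0) (x \in is_diagonal).
Proof. exact: asboolP. Qed.

Lemma is_diagonal_subring_closed : subring_closed is_diagonal.
Proof.
split=> [|x y /is_diagonalP x0 /is_diagonalP y0|x y /is_diagonalP x0 /is_diagonalP y0];
    apply/is_diagonalP => k l kl.
- by apply: mhunit_eq0; rewrite xpair_eqE; lia.
- by rewrite mhringDE mhringNE x0 // y0 // subr0.
- rewrite /= /mhmul_comp big1 // => k1 _; rewrite big1 // => l1 _.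
  have [/eqP kl1|kl1] := boolP (k1 == l1 :> nat).
    have kl2 : (k - k1)%N <> (l - l1)%N.
      by have := ltn_ord k1; have := ltn_ord l1; lia.
    by rewrite [y _ _]y0 // mhcup0r.
  by rewrite [x _ _]x0 ?mhcup0l //; apply/eqP.
Qed.

HB.instance Definition _ := GRing.isSubringClosed.Build mhring is_diagonal
  is_diagonal_subring_closed.

Record diagonal_mhring := DiagonalMHRing {
  diagonal_val :> mhring;
  _ : diagonal_val \in is_diagonal }.

HB.instance Definition _ := [isSub for diagonal_val].
HB.instance Definition _ := [Choice of diagonal_mhring by <:].
HB.instance Definition _ := GRing.SubChoice_isSubPzRing.Build mhring
  is_diagonal diagonal_mhring is_diagonal_subring_closed.

Definition diagonal_homog (n : nat) (x : diagonal_mhring) : Prop :=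
  forall k l, (k, l) <> (n, n) -> (val x : mhring) k l = 0.

End MagnitudeRing.

(* Main.v *)
From HB Require Import structures.
Require Import Defs.
From mathcomp Require Import all_boot all_algebra.
From mathcomp Require Import boolp finmap monalg zify.

Set Implicit Arguments.
Unset Strict Implicit.
Unset Printing Implicit Defensive.

Import GRing.Theory.
Local Open Scope ring_scope.

(** Two distinct vertices of a graph are at distance at least 1, so a k-simplex
    has length at least k, and a k-simplex of length exactly k is the same thing
    as an edge path of length k. Hence MC_{k,k} is free on the edge paths of
    length k, while MC_{k+1,k} vanishes: every cochain of bidegree (k,k) is a
    cocycle, and the degree k part of the path algebra is identified with the
    group of cocycles of bidegree (k,k) by sending f to the cochain which reads
    off the coefficients of f. Splitting an edge path in two is dual to
    concatenation, so this identification takes the product of the path algebra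
    to the cup product ([pcoefM]), and passing to cohomology classes gives a ring
    morphism [path_diagonal] onto the diagonal part of the cohomology ring.

    It remains to match the coboundaries of bidegree (k,k) with the ideal
    generated by the relators. The relator of a pair x, z at distance 2 is, up to
    sign, the coboundary of the dual of the 1-simplex (x,z) of length 2, so the
    ideal is killed ([path_diagonal_ideal_eq0]). Conversely, MC_{k-1,k} is free on
    simplices which have one step of length 2 and all others of length 1. An inner
    face of an edge path is nonzero only when it deletes the midpoint of two steps
    joining vertices a, c at distance 2; hence, for a fixed simplex
    u a c r and a fixed position, the edge paths having it as their face there
    are the u a b c r with b a common neighbour of a and c, and
    their sum is (u a) * relator a c * (c r), an element of the ideal
    ([sum_midpoints_in_ideal]). A coboundary is a combination of such sums
    ([pathsum_cobdry_in_ideal]), so the kernel is the ideal, and the first isomorphism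
    theorem [quotring_iso] yields the required isomorphism, which respects degrees
    because [path_diagonal] does. *)

(** * Quotients by two-sided ideals *)

(** The first isomorphism theorem, with the isomorphism directed from the target
    of the morphism to the quotient. *)
Lemma quotring_iso (A B : pzRingType) (S : A -> Prop) (h : {rmorphism A -> B}) :
  (forall b, exists a, h a = b) -> (forall a, h a = 0 <-> a \in ideal_gen S) ->
  exists f : {rmorphism B -> quotring S},
    bijective f /\ forall a, f (h a) = qproj S a.
Proof.
move=> surj ker.
(* A preimage of b is defined up to the kernel, which the projection kills. *)
pose f b : quotring S := qproj S (sval (cid (surj b))).
have hE a : f (h a) = qproj S a.
  by apply/qproj_eq/ker; rewrite rmorphB /=; case: cid => a' /= ->; rewrite subrr.
have fB : zmod_morphism f.
  move=> b b'; have [a <-] := surj b; have [a' <-] := surj b'.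
  rewrite -rmorphB !hE; apply: (addIr (qproj S a')).
  by rewrite -qprojD !subrK.
have fM : monoid_morphism f.
  split=> [|b b']; first by rewrite -(rmorph1 h) hE.
  have [a <-] := surj b; have [a' <-] := surj b'.
  by rewrite -rmorphM !hE qprojM.
pose MA := GRing.isZmodMorphism.Build _ _ f fB.
pose MM := GRing.isMonoidMorphism.Build _ _ f fM.
pose F : {rmorphism B -> quotring S} := HB.pack f MA MM.
exists F; split=> //.
have qK q : qproj S (repr q) = q by rewrite /qproj reprK.
exists (fun q : quotring S => h (repr q)) => [b|q] /=; last by rewrite hE qK.
have [a <-] := surj b; rewrite hE; apply/eqP; rewrite -subr_eq0 -rmorphB.
by apply/eqP/ker/qproj_eq; rewrite qK.
Qed.

(** * Lengths of simplices in a graph *)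

Section GraphDistanceValues.
Variables (T : finType) (e : rel T).
Hypothesis e_irr : irreflexive e.

Lemma walk0 x y : walk e x y 0 = (x == y).
Proof.
rewrite /walk; apply/existsP/eqP => [[p]|->]; first by rewrite tuple0 /= => /eqP.
by exists [tuple]; rewrite /= eqxx.
Qed.

Lemma walk1 x y : walk e x y 1 = e x y.
Proof.
rewrite /walk; apply/existsP/idP => [[[[|z []] // sz]]|exy].
  by rewrite /= andbT => /andP[exz /eqP <-].
by exists [tuple y]; rewrite /= exy eqxx.
Qed.

Lemma gdist_eq0 x y : (gdist e x y == Some 0%N) = (x == y).
Proof.
rewrite -walk0 /gdist; case: pselect => [ex|nex].
  case: ex_minnP => n wn min_n; apply/eqP/idP => [[<-]//|/min_n].
  by rewrite leqn0 => /eqP ->.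
by apply/idP/idP => // w; case: nex; exists 0%N.
Qed.

Lemma gdist_eq1 x y : (gdist e x y == Some 1%N) = e x y.
Proof.
rewrite -walk1 /gdist; case: pselect => [ex|nex].
  case: ex_minnP => -[|n] wn min_n.
    move: wn; rewrite walk0 => /eqP <-.
    by rewrite walk1 e_irr.
  apply/eqP/idP => [[n0]|/min_n]; first by rewrite n0 in wn.
  by rewrite ltnS leqn0 => /eqP ->.
by apply/idP/idP => // w; case: nex; exists 1%N.
Qed.

Lemma path_slength x s : path e x s -> slength (gdist e) (x :: s) = Some (size s).
Proof.
elim: s x => //= y s IH x /andP[exy /IH] /= ->.
by move: exy; rewrite -gdist_eq1 => /eqP ->.
Qed.

(** Each step between distinct vertices contributes at least 1, so equality
    forces every step to contribute exactly 1, that is, to be an edge. *)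
Lemma slength_ge x s l : path (fun x y => x != y) x s ->
  slength (gdist e) (x :: s) = Some l ->
  (size s <= l)%N /\ (size s = l -> path e x s).
Proof.
elim: s x l => [|y s IH] x l //= /andP[xy /IH {}IH].
have := gdist_eq0 x y; have := gdist_eq1 x y; rewrite (negPf xy).
case: (gdist e x y) => [[|[|n]]|] //= dxy _; move: IH => /=;
  case: foldr => [m|] //= /(_ m erefl)[le_m eq_m] [<-].
  by split; [lia|move=> []]; rewrite -dxy eqxx => /eq_m.
by split; lia.
Qed.

Lemma simp_diag k s : simp (gdist e) k k s = (size s == k.+1) && is_edge_path e s.
Proof.
rewrite /simp; case: eqP => //= sz; rewrite /is_simplex.
case: s sz => // x s [sz]; apply/andP/idP => [[so /eqP ls]|pxs].
  by have [_ /(_ sz)] := slength_ge so ls.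
rewrite path_slength // sz; split=> //=; apply: sub_path pxs => y z eyz.
by apply: contraTneq eyz => ->; rewrite e_irr.
Qed.

(** This is what makes every cochain on the diagonal a cocycle. *)
Lemma simp_above_diag k l s : (l < k)%N -> simp (gdist e) k l s = false.
Proof.
move=> lk; apply/negP => /andP[/eqP sz /andP[so /eqP ls]].
case: s sz so ls => // x s [sz] so ls.
by have [] := slength_ge so ls; rewrite sz leqNgt lk.
Qed.

End GraphDistanceValues.

(** * Coefficients of elements of the path algebra *)

Section PathCoefficients.
Variables (T : finType) (e : rel T).

(** Coefficients are indexed by arbitrary sequences, with value 0 outside edge
    paths, so that they can be compared with cochains evaluated on arbitrary
    tuples. *)
Definition pcoef (s : seq T) (f : path_algebra e) : int :=
  if insub s is Some p then f@_(p : edge_path e) else 0.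

Lemma pcoef_val f (p : edge_path e) : pcoef (val p) f = f@_p.
Proof. by rewrite /pcoef valK. Qed.

Lemma pcoef_out f s : ~~ is_edge_path e s -> pcoef s f = 0.
Proof. by move=> sN; rewrite /pcoef insubN. Qed.

Lemma pcoef_is_zmod_morphism s : zmod_morphism (pcoef s).
Proof.
move=> f g; rewrite /pcoef; case: insub => [p|]; last by rewrite subr0.
by rewrite mcoeffB.
Qed.

HB.instance Definition _ s :=
  GRing.isZmodMorphism.Build (path_algebra e) int (pcoef s)
    (pcoef_is_zmod_morphism s).

Lemma pcoefP f g : (forall s, pcoef s f = pcoef s g) -> f = g.
Proof. by move=> fg; apply/malgP => p; rewrite -!pcoef_val. Qed.

Lemma pcoef_pbasis s t :
  pcoef t (pbasis e s) = (is_edge_path e s && (s == t))%:R.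
Proof.
have [es|esN] := boolP (is_edge_path e s); last by rewrite pbasis0 // raddf0.
have [<-{t}|st] := eqVneq s t => /=.
  rewrite -[s]/(val (exist (is_edge_path e) s es : edge_path e)).
  by rewrite pbasisE pcoef_val mcoeffUU.
have [et|/pcoef_out -> //] := boolP (is_edge_path e t).
rewrite -[s]/(val (exist (is_edge_path e) s es : edge_path e)) pbasisE.
rewrite -[t]/(val (exist (is_edge_path e) t et : edge_path e)) pcoef_val.
rewrite mcoeffU; case: eqP => // /(congr1 val) /= st'.
by rewrite st' eqxx in st.
Qed.

Lemma pcoef_large f : exists N, forall s, (N < size s)%N -> pcoef s f = 0.
Proof.
exists (\max_(p <- msupp f) size (val p)) => s; apply: contraTeq.
rewrite -leqNgt /pcoef; case: insubP => [p _ <-|]; last by rewrite eqxx.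
rewrite mcoeff_neq0 => pf.
exact: (@leq_bigmax_seq _ _ _ (fun p : edge_path e => size (val p))).
Qed.

Lemma pcoef_one s : pcoef s (1 : path_algebra e) = (size s == 1%N)%:R.
Proof.
rewrite /GRing.one /= /pone raddf_sum /=.
under eq_bigr => x _ do rewrite pcoef_pbasis /=.
case: s => [|x [|y s]]; last 1 first.
- by rewrite big1 // => z _; case: eqP.
- by rewrite big1.
rewrite (bigD1 x) //= eqxx big1 ?addr0 // => y yx.
by case: eqP => // -[yx']; rewrite yx' eqxx in yx.
Qed.

(** Concatenation is dual to deconcatenation: an edge path arises as a product
    of two basis elements once for each of its vertices. This is the formula of
    the cup product, summed over the bidegrees of the two factors. *)
Lemma pcoefM s f g : pcoef s (f * g) =
  \sum_(i < size s) pcoef (take i.+1 s) f * pcoef (drop i s) g.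
Proof.
elim/path_algebra_ind: f => [|f f' IH IH'|f IH|x u xu].
- by rewrite mul0r raddf0 big1 // => i _; rewrite raddf0 mul0r.
- rewrite mulrDl raddfD /= IH IH' -big_split; apply: eq_bigr => i _ /=.
  by rewrite raddfD mulrDl.
- rewrite mulNr raddfN /= IH -sumrN; apply: eq_bigr => i _.
  by rewrite raddfN mulNr.
elim/path_algebra_ind: g => [|g g' IH IH'|g IH|y v yv].
- by rewrite mulr0 raddf0 big1 // => i _; rewrite raddf0 mulr0.
- rewrite mulrDr raddfD /= IH IH' -big_split; apply: eq_bigr => i _ /=.
  by rewrite raddfD mulrDr.
- rewrite mulrN raddfN /= IH -sumrN; apply: eq_bigr => i _.
  by rewrite raddfN mulrN.
rewrite [_ * _]pmulE.
under eq_bigr => i _ do rewrite !pcoef_pbasis /= xu yv -natrM mulnb /=.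
(* A splitting of s into x u and y v can only happen at position size u. *)
have splitE i : (i < size s)%N ->
    (x :: u == take i.+1 s) && (y :: v == drop i s) =
    [&& i == size u, last x u == y & x :: u ++ v == s].
  move=> i_s; apply/andP/and3P => [[/eqP us /eqP vs]|[/eqP-> /eqP<- /eqP<-]].
    have iu : i = size u.
      by move/(congr1 size): us; rewrite size_takel //= => -[].
    move: us vs; rewrite (take_nth y) // (drop_nth y) // => us [yE vE].
    split; [exact/eqP|by rewrite -[last x u]/(last y (x :: u)) us last_rcons -yE|].
    by rewrite -cat_cons us vE -take_nth // cat_take_drop.
  rewrite -cat_cons take_size_cat // eqxx; split=> //.
  by rewrite (lastI x u) cat_rcons drop_size_cat ?size_belast.
under eq_bigr => i _ do rewrite splitE //.
have [sE|sN] := boolP ((last x u == y) && (x :: u ++ v == s)); last first.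
  rewrite big1 => [|i _]; last by rewrite andbF.
  case: ifP sN => [_ /= sN|]; last by rewrite raddf0.
  by rewrite pcoef_pbasis (negPf sN) andbF.
have {sE}[yE sE] := andP sE.
have us : (size u < size s)%N by rewrite -(eqP sE) /= size_cat; lia.
rewrite yE (bigD1 (Ordinal us)) //= eqxx big1 ?addr0 => [|i]; last first.
  by rewrite -val_eqE /= => /negPf ->.
by rewrite pcoef_pbasis sE andbT /= cat_path xu (eqP yE) yv.
Qed.

End PathCoefficients.

(** * Diagonal cochains and the path algebra *)

Section DiagonalCochains.
Variables (T : finType) (e : rel T).
Hypothesis e_irr : irreflexive e.
Notation d := (gdist e).

(** Off the diagonal the cochain is 0, so that a family indexed by all bidegrees
    is attached to f. *)
Definition path_cochain k l (f : path_algebra e) : cochain d k l :=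
  linext (fun x : simplex d k l =>
    (if k == l then pcoef (val x) f else 0) : int^o).

Lemma path_cochainE k l f s : path_cochain k l f (sbasis d k l s) =
  if (k == l) && (size s == k.+1) then pcoef s f else 0.
Proof.
have [ss|sN] := boolP (simp d k l s).
  have [x ->] := simpP ss.
  by rewrite linext_val size_tuple eqxx andbT.
rewrite ev_not_simp //; case: eqP sN => //= <-; rewrite simp_diag //.
by case: eqP => //= _ sN; rewrite pcoef_out.
Qed.

(** The coboundary of a diagonal cochain lives in bidegree (k+1,k), where there
    are no simplices. *)
Lemma path_cochain_cocycle k l f : path_cochain k l f \in @is_cocycle T d k l.
Proof.
rewrite unfold_in; apply/eqP; apply: cochainP => s.
have [->|kl] := eqVneq k l; first by rewrite simp_above_diag.
move=> _; suff -> : path_cochain k l f = 0 by rewrite /cobdry comp_lfun0l.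
by apply: cochainP => t _; rewrite path_cochainE (negPf kl) zero_lfunE.
Qed.

Lemma path_cochain_is_zmod_morphism k l : zmod_morphism (path_cochain k l).
Proof.
move=> f g; apply: cochainP => s _.
rewrite add_lfunE opp_lfunE !path_cochainE raddfB /=.
by case: ifP => // _; rewrite subr0.
Qed.

HB.instance Definition _ k l :=
  GRing.isZmodMorphism.Build (path_algebra e) (cochain d k l) (path_cochain k l)
    (@path_cochain_is_zmod_morphism k l).

Definition path_class k l f : MH d k l :=
  mhclass (Cocycle (path_cochain_cocycle k l f)).

Lemma path_class_eq0 k l f :
  path_class k l f = 0 <-> cobdry_image (path_cochain k l f).
Proof.
by rewrite -mhclass0; split=> [/mhclass_eq|h]; [|apply/mhclass_eq]; rewrite subr0.
Qed.

Lemma path_class_is_zmod_morphism k l : zmod_morphism (path_class k l).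
Proof.
move=> f g; apply: (addIr (path_class k l g)); rewrite subrK -mhclassD.
by apply: mhclass_inj_val; rewrite /= -raddfD subrK.
Qed.

HB.instance Definition _ k l :=
  GRing.isZmodMorphism.Build (path_algebra e) (MH d k l) (path_class k l)
    (@path_class_is_zmod_morphism k l).

Lemma path_class_eq k l f g : (forall s, size s = k.+1 -> pcoef s f = pcoef s g) ->
  path_class k l f = path_class k l g.
Proof.
move=> fg; apply: mhclass_inj_val; apply: cochainP => s _.
by rewrite !path_cochainE; case: ifP => // /andP[_ /eqP /fg].
Qed.

Lemma path_class_off_diag k l f : k <> l -> path_class k l f = 0.
Proof.
move=> /eqP kl; rewrite -mhclass0; apply: mhclass_inj_val; apply: cochainP => s _.
by rewrite path_cochainE (negPf kl) zero_lfunE.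
Qed.

(** Inverse to [path_cochain] on the homogeneous elements of degree k. *)
Definition pathsum k (phi : cochain d k k) : path_algebra e :=
  \sum_(x : simplex d k k) pbasis e (val x) *~ phi (sbasis d k k (val x)).

Lemma pcoef_pathsum k (phi : cochain d k k) s :
  pcoef s (pathsum phi) = phi (sbasis d k k s).
Proof.
rewrite raddf_sum /=.
have [ss|sN] := boolP (simp d k k s); last first.
  rewrite ev_not_simp // big1 // => x _; rewrite raddfMz /= pcoef_pbasis.
  case: eqP => [xs|_]; last by rewrite andbF mul0rz.
  by rewrite -xs simp_val in sN.
have [x sE] := simpP ss; rewrite sE (bigD1 x) //= big1 => [|y yx].
  rewrite addr0 raddfMz /= pcoef_pbasis eqxx.
  by move: ss; rewrite simp_diag // sE => /andP[_ ->]; rewrite intz.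
rewrite raddfMz /= pcoef_pbasis; case: eqP => [xy|_]; last by rewrite andbF mul0rz.
by case/eqP: yx; do 2!apply: val_inj.
Qed.

Lemma pathsum_is_zmod_morphism k : zmod_morphism (@pathsum k).
Proof.
move=> phi psi; apply: pcoefP => s; rewrite raddfB /= !pcoef_pathsum.
by rewrite add_lfunE opp_lfunE.
Qed.

HB.instance Definition _ k :=
  GRing.isZmodMorphism.Build (cochain d k k) (path_algebra e) (@pathsum k)
    (@pathsum_is_zmod_morphism k).

Lemma path_cochainK k : cancel (@pathsum k) (path_cochain k k).
Proof.
move=> phi; apply: cochainP => s ss; rewrite path_cochainE eqxx.
by case/andP: ss => /= -> _; rewrite pcoef_pathsum.
Qed.

Lemma pathsum_path_cochain k f s :
  pcoef s (pathsum (path_cochain k k f)) = if size s == k.+1 then pcoef s f else 0.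
Proof. by rewrite pcoef_pathsum path_cochainE eqxx. Qed.

Lemma path_algebra_split f : exists N, f = \sum_(k < N) pathsum (path_cochain k k f).
Proof.
have [N fN] := pcoef_large f; exists N; apply: pcoefP => s.
rewrite raddf_sum; under eq_bigr => k _ do rewrite /= pathsum_path_cochain.
have [sN|/fN ->] := leqP (size s) N; last by rewrite big1 // => k _; case: ifP.
case: s sN => [|x s] sN; first by rewrite pcoef_out // big1.
rewrite (bigD1 (Ordinal sN)) //= eqxx big1 ?addr0 // => k.
by rewrite -val_eqE /= eqSS eq_sym => /negPf ->.
Qed.

Lemma phomog_pathsum k (phi : cochain d k k) : phomog k (pathsum phi).
Proof.
move=> p; rewrite -mcoeff_neq0 -pcoef_val pcoef_pathsum => phi_p; apply/eqP.
by apply: contraNT phi_p => pk; rewrite ev_not_simp // /simp (negPf pk).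
Qed.

(** * The morphism to the diagonal cohomology ring *)

Fact path_mhring_finite f : exists N, forall k l,
  (N <= k)%N || (N <= l)%N -> path_class k l f = 0.
Proof.
have [N fN] := pcoef_large f; exists N => k l kl.
have [kl'|/eqP/path_class_off_diag //] := eqVneq k l.
rewrite -[RHS](raddf0 (path_class k l)); apply: path_class_eq => s sk.
by rewrite raddf0 fN // sk; lia.
Qed.

Definition path_mhring f : mhring d := MHRing (path_mhring_finite f).

Lemma path_mhring_diagonal f : path_mhring f \in @is_diagonal T d.
Proof. by apply/is_diagonalP => k l /path_class_off_diag; apply. Qed.

Definition path_diagonal f : diagonal_mhring d :=
  DiagonalMHRing (path_mhring_diagonal f).

Lemma path_diagonal_is_zmod_morphism : zmod_morphism path_diagonal.
Proof.
by move=> f g; apply: val_inj; apply: mhringP => k l; rewrite /= raddfB.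
Qed.

Lemma mhclass_sum k l I r (P : pred I) (F : I -> cocycle d k l) :
  mhclass (\sum_(i <- r | P i) F i) = \sum_(i <- r | P i) mhclass (F i).
Proof. exact: (big_morph _ (@mhclassD _ _ _ _) (@mhclass0 _ _ _ _)). Qed.

Lemma cocycle_sumE k l I r (P : pred I) (F : I -> cocycle d k l) c :
  val (\sum_(i <- r | P i) F i) c = \sum_(i <- r | P i) val (F i) c.
Proof.
apply: (big_morph (fun z : cocycle d k l => val z c)) => [z w|].
  by rewrite raddfD add_lfunE.
by rewrite raddf0 zero_lfunE.
Qed.

Lemma path_diagonal_is_monoid_morphism : monoid_morphism path_diagonal.
Proof.
split=> [|f g]; apply: val_inj; apply: mhringP => k l /=.
  apply: mhclass_inj_val; apply: cochainP => s ss.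
  rewrite path_cochainE pcoef_one; have [x sE] := simpP ss.
  rewrite sE linext_val size_tuple eqxx andbT eqSS.
  by case: (k) (l) => [|k'] [|l']; rewrite //= if_same.
rewrite /mhmul_comp; under eq_bigr => i _.
  under eq_bigr => j _ do rewrite mhcup_class.
  rewrite -mhclass_sum; over.
rewrite -mhclass_sum; apply: mhclass_inj_val; apply: cochainP => s ss.
case/andP: (ss) => /eqP sk _; rewrite path_cochainE sk eqxx andbT.
rewrite cocycle_sumE.
under eq_bigr => i _.
  rewrite cocycle_sumE /=.
  under eq_bigr => j _.
    rewrite cup_val // !path_cochainE size_take size_drop sk.
    over.
  over.
have [<-{l ss}|kl] := eqVneq k l; last first.
  rewrite big1 // => i _; rewrite big1 // => j _.
  have := ltn_ord i; have := ltn_ord j.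
  have [ij|_] := eqVneq (i : nat) j; last by rewrite mul0r.
  have [ij'|_] := eqVneq (k - i)%N (l - j)%N; last by rewrite mulr0.
  by move: kl => /eqP; lia.
(* On the diagonal, the only splitting of bidegrees that contributes is (i, i),
   (k - i, k - i); elsewhere one of the two factors is off the diagonal. *)
rewrite pcoefM sk; apply: eq_bigr => i _; have := ltn_ord i => ik.
rewrite (bigD1 i) //= !eqxx big1 => [|j ji].
  by rewrite addr0 /=; case: ltnP => ?; rewrite ?eqxx; (do ?case: eqP => //); lia.
by rewrite val_eqE eq_sym (negPf ji) mul0r.
Qed.

HB.instance Definition _ :=
  GRing.isZmodMorphism.Build (path_algebra e) (diagonal_mhring d) path_diagonal
    path_diagonal_is_zmod_morphism.
HB.instance Definition _ :=
  GRing.isMonoidMorphism.Build (path_algebra e) (diagonal_mhring d) path_diagonal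
    path_diagonal_is_monoid_morphism.

Lemma path_class_phomog_eq0 j k l f : phomog k f -> (j, l) <> (k, k) ->
  path_class j l f = 0.
Proof.
move=> fk jl; have [jE|/eqP/path_class_off_diag //] := eqVneq j l.
rewrite -(raddf0 (path_class j l)); apply: path_class_eq => s sj.
rewrite raddf0 /pcoef; case: insubP => // p _ pE.
apply/eqP; rewrite mcoeff_eq0; apply/negP => /fk; rewrite pE sj => -[jk].
by apply: jl; rewrite -jE jk.
Qed.

Lemma path_class_surj k (a : MH d k k) :
  exists f, phomog k f /\ path_class k k f = a.
Proof.
have [z ->] := mhclass_surj a; exists (pathsum (val z)).
split; first exact: phomog_pathsum.
by apply: mhclass_inj_val; rewrite /= path_cochainK.
Qed.

Lemma path_diagonal_homog k f : phomog k f -> diagonal_homog k (path_diagonal f).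
Proof. by move=> fk j l; apply: path_class_phomog_eq0. Qed.

Lemma path_diagonal_homog_surj k (x : diagonal_mhring d) : diagonal_homog k x ->
  exists f, phomog k f /\ path_diagonal f = x.
Proof.
move=> xk; have [f [fk fE]] := path_class_surj ((val x : mhring d) k k).
exists f; split=> //; apply: val_inj; apply: mhringP => j l.
have [[-> ->]|/eqP jl] := eqVneq (j, l) (k, k); first exact: fE.
by rewrite xk //; apply: path_class_phomog_eq0 jl.
Qed.

Lemma path_diagonal_surj (x : diagonal_mhring d) : exists f, path_diagonal f = x.
Proof.
have [N xN] := mhcomp_finite (val x).
have [F FP] := boolp.choice (fun k => path_class_surj ((val x : mhring d) k k)).
exists (\sum_(k < N) F k); apply: val_inj; apply: mhringP => j l /=.
have [<-{l}|/eqP jl] := eqVneq j l; last first.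
  by rewrite path_class_off_diag //; have /is_diagonalP-> := valP x.
rewrite raddf_sum /=; have [jN|jN] := ltnP j N.
  rewrite (bigD1 (Ordinal jN)) //= (proj2 (FP j)) big1 ?addr0 // => k.
  rewrite -val_eqE /= => /eqP kj.
  by apply: path_class_phomog_eq0 (proj1 (FP k)) _ => -[] /esym.
rewrite xN ?jN // big1 // => k _.
apply: path_class_phomog_eq0 (proj1 (FP k)) _ => -[jk _].
by have := ltn_ord k; rewrite -jk ltnNge jN.
Qed.

(** * The kernel of the morphism *)

(** The relator is minus the coboundary of the dual of the 1-simplex (x,z), the
    sign being that of the only inner face of a 2-simplex. *)
Lemma path_class_relator x z k l : gdist e x z = Some 2%N ->
  path_class k l (relator e x z) = 0.
Proof.
move=> xz.
have rhom : phomog 2 (relator e x z).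
  move=> p; rewrite -mcoeff_neq0 -pcoef_val raddf_sum /=; apply: contraNeq => p2.
  rewrite big1 // => y _; rewrite pcoef_pbasis; case: eqP; last by rewrite andbF.
  by move=> pE; rewrite -pE in p2.
have [[-> ->]|/eqP] := eqVneq (k, l) (2, 2)%N; last exact: path_class_phomog_eq0.
apply/path_class_eq0; exists (linext (fun s : simplex d 1 2 =>
  - (tval (val s) == [:: x; z])%:R : int^o)).
have dualE s : linext (fun s : simplex d 1 2 =>
    - (tval (val s) == [:: x; z])%:R : int^o) (sbasis d 1 2 s) =
    - (s == [:: x; z])%:R.
  have [/simpP[s' ->]|sN] := boolP (simp d 1 2 s); first by rewrite linext_val.
  rewrite ev_not_simp //; case: eqP => [sE|]; last by rewrite oppr0.
  suff xNz : x != z by rewrite sE /simp /is_simplex /= xNz xz in sN.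
  by rewrite -(gdist_eq0 e) xz.
apply: cochainP => s ss; rewrite path_cochainE.
case/andP: (ss) => /eqP sz /andP[so ls]; rewrite cobdry_ev // sz /= raddf_sum /=.
move: ss; rewrite simp_diag // sz /=.
case: s sz so ls => [|a [|b [|c []]]] //= _ _ _ /and3P[eab ebc _].
rewrite /cobdry_seq big_nat1 expr1 mulN1r (@faceE _ _ _ _ 0 [::]) //=.
have := eab; have := ebc; rewrite -!(gdist_eq1 e_irr) => /eqP bc /eqP ab.
rewrite ab bc /=; under eq_bigr => y _ do rewrite pcoef_pbasis.
under eq_bigr => y _ do rewrite eqseq_cons.
(* If a, c are not at distance 2 then (a,c) differs from (x,z), and both sides are
   0; otherwise only the term y = b of the relator can be nonzero. *)
have [acE|acN] := eqVneq (d a c) (Some 2%N); last first.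
  rewrite linear0 oppr0 big1 // => y /andP[xy yz]; case: and3P => //.
  case=> _ /eqP ax; rewrite !eqseq_cons => /and3P[_ /eqP cz _].
  by rewrite -ax -cz xz in acN.
rewrite dualE opprK.
have [[ax cz]|acNxz] := eqVneq [:: a; c] [:: x; z].
  rewrite -ax -cz (bigD1 b) /= ?ab ?bc // eab ebc !eqxx big1 ?addr0 // => y.
  by case/andP=> _ /negPf yb; rewrite eqseq_cons yb !andbF.
rewrite big1 // => y _; case: and3P => // -[_ /eqP ax /eqP[_ cz]].
by rewrite ax cz eqxx in acNxz.
Qed.

Notation ideal := (ideal_gen (relators (e := e))).

Lemma path_diagonal_ideal_eq0 f : f \in ideal -> path_diagonal f = 0.
Proof.
move=> /ideal_genP f_ideal; apply: (f_ideal (fun f => path_diagonal f = 0)).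
  split=> [|f' g f0 g0|a f' f0|a f' f0]; first exact: raddf0.
  - by rewrite raddfB /= f0 g0 subr0.
  - by rewrite rmorphM /= f0 mulr0.
  - by rewrite rmorphM /= f0 mul0r.
move=> _ [x [z [xz ->]]].
by apply: val_inj; apply: mhringP => k l; exact: path_class_relator.
Qed.

Lemma pbasis_cat u a b c r :
  pbasis e (rcons u a) * pbasis e [:: a; b; c] * pbasis e (c :: r) =
  pbasis e (u ++ [:: a, b, c & r]).
Proof.
have -> : pbasis e (rcons u a) * pbasis e [:: a; b; c] =
          pbasis e (rcons u a ++ [:: b; c]).
  case: u => [|x u] /=; rewrite [LHS]pmulE /= ?eqxx //.
  by rewrite last_rcons eqxx.
by case: u => [|x u] /=; rewrite [LHS]pmulE ?last_cat /= eqxx // cat_rcons -catA.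
Qed.

(** Inserting a midpoint between a and c in all possible ways gives a multiple of
    a relator; the b which are not common neighbours contribute 0, as the
    sequences obtained from them are not edge paths. *)
Lemma sum_midpoints_in_ideal u a c r : gdist e a c = Some 2%N ->
  \sum_b pbasis e (u ++ [:: a, b, c & r]) \in ideal.
Proof.
move=> ac.
have -> : \sum_b pbasis e (u ++ [:: a, b, c & r]) =
          pbasis e (rcons u a) * relator e a c * pbasis e (c :: r).
  rewrite mulr_sumr mulr_suml [RHS]big_mkcond; apply: eq_bigr => b _.
  rewrite !gdist_eq1 // pbasis_cat; case: ifP => // /negP nabc.
  apply: pbasis0; apply/negP; rewrite -cat_rcons => euv; apply: nabc.
  case: u euv => [|x u] /=; first by case/and3P=> -> ->.
  by rewrite cat_path last_rcons /= => /and4P[_ -> ->].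
apply/ideal_genMr/ideal_genMl/ideal_genP => I _ relI; apply: relI.
by exists a, c.
Qed.

Lemma sum_simplex_pbasis k s : size s = k.+1 ->
  \sum_(x : simplex d k k) pbasis e (val x) *~ (tval (val x) == s)%:R =
  pbasis e s.
Proof.
move=> sz; have [/simpP[x ->]|sN] := boolP (simp d k k s).
  rewrite (bigD1 x) //= eqxx mulr1z big1 ?addr0 // => y yx.
  case: eqP => [xy|]; last by rewrite mulr0z.
  by case/eqP: yx; do 2!apply: val_inj.
rewrite big1 => [|x _]; first by move: sN; rewrite simp_diag // sz eqxx => /pbasis0.
by case: eqP => [xs|]; rewrite ?mulr0z // -xs simp_val in sN *.
Qed.

(** In an edge path the two steps around a vertex have total length 2, so the face
    deleting it is nonzero exactly when its neighbours a, c are at distance 2, and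
    the edge paths with a given face differ only in the deleted vertex b. *)
Lemma face_coef k (y : simplex d k k.+1) s u a c r :
  size s = k.+2 -> is_edge_path e s -> tval (val y) = u ++ [:: a, c & r] ->
  face d k k.+1 (size u).+1 s y =
  if d a c == Some 2%N then \sum_b (s == u ++ [:: a, b, c & r])%:R else 0 :> int.
Proof.
move=> sz es yE.
have [|u' [a' [b' [c' [r' [szu sE]]]]]] := @face_split _ (size u) s.
  by have := size_tuple (val y); rewrite yE size_cat sz /=; lia.
have /andP[ab bc] : e a' b' && e b' c'.
  move: es; rewrite sE; case: (u') => [|x v] /=; first by case/and3P=> -> ->.
  by rewrite cat_path /= => /and4P[_ _ -> /andP[-> _]].
move: ab bc; rewrite -!(gdist_eq1 e_irr) => /eqP ab /eqP bc.
rewrite sE faceE // ab bc /=.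
have -> : \sum_b (u' ++ [:: a', b', c' & r'] == u ++ [:: a, b, c & r])%:R =
    (u ++ [:: a, c & r] == u' ++ [:: a', c' & r'])%:R :> int.
  rewrite (bigD1 b') //= big1 => [|b bb'].
    rewrite addr0 !eqseq_cat // !eqseq_cons eqxx /=.
    by rewrite [u == _]eq_sym [a == _]eq_sym [c == _]eq_sym [r == _]eq_sym.
  by rewrite eqseq_cat // !eqseq_cons [b' == _]eq_sym (negPf bb') !andbF.
rewrite -[(1 + 1)%N]/2%N; have [E|/negPf N] := eqVneq (u ++ _) (u' ++ _).
  have /and4P[_ /eqP aa' /eqP cc' _] : [&& u == u', a == a', c == c' & r == r'].
    by rewrite -!eqseq_cons -eqseq_cat //; exact/eqP.
  by rewrite aa' cc'; case: ifP => _; rewrite ffunE // yE E eqxx.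
by rewrite if_same; case: ifP => _; rewrite ffunE // yE N.
Qed.

Lemma pathsum_face_in_ideal k (psi : cochain d k k.+1) i : (0 < i < k.+1)%N ->
  \sum_(x : simplex d k.+1 k.+1)
    pbasis e (val x) *~ psi (face d k k.+1 i (val x)) \in ideal.
Proof.
case: i => // i ik.
(* By linearity in psi, it is enough to consider the duals of simplices y. *)
under eq_bigr => x _.
  rewrite [face _ _ _ _ _]chainE linear_sum raddf_sum /=.
  under eq_bigr => y _ do rewrite linearZ /= [_ *: _]mulrC mulrC mulrzA.
  over.
rewrite exchange_big rpred_sum // => y _ /=.
rewrite -mulrz_suml rpredMz //.
have := size_tuple (val y); have := cat_take_drop i (val y).
have : size (drop i (val y)) = (k.+1 - i)%N by rewrite size_drop size_tuple.
have : size (take i (val y)) = i by rewrite size_takel // size_tuple; lia.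
case: (drop i (val y)) => [|a [|c r]] /=; try lia.
move: (take i (val y)) => u su _ /esym yE sy.
(* Now y = u a c r, and the deleted vertex stood between a and c. *)
have yface (x : simplex d k.+1 k.+1) :=
  @face_coef k y (val x) u a c r (size_tuple _) _ yE.
have xpath (x : simplex d k.+1 k.+1) : is_edge_path e (val x).
  by have := simp_val x; rewrite simp_diag // => /andP[].
rewrite -su.
under eq_bigr => x _ do rewrite yface //.
case: eqP => [ac|_]; last by rewrite big1 ?rpred0 // => x _; rewrite mulr0z.
rewrite (_ : \sum_x _ = \sum_b pbasis e (u ++ [:: a, b, c & r])).
  exact: sum_midpoints_in_ideal.
under eq_bigr => x _ do rewrite raddf_sum /=.
rewrite exchange_big; apply: eq_bigr => b _ /=.
apply: sum_simplex_pbasis.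
by move: sy; rewrite yE !size_cat /=; lia.
Qed.

Lemma pathsum_cobdry_in_ideal k (psi : cochain d k k.+1) :
  pathsum (cobdry psi) \in ideal.
Proof.
rewrite /pathsum; under eq_bigr => x _.
  have /andP[/eqP sz /andP[so _]] := simp_val x.
  rewrite cobdry_ev // /cobdry_seq [X in _ *~ X]big_nat raddf_sum /=.
  under eq_bigr => i _ do rewrite mulrC mulrzA.
  over.
rewrite exchange_big rpred_sum // => i ik /=.
by rewrite -mulrz_suml rpredMz // pathsum_face_in_ideal.
Qed.

(** Vanishing in cohomology is a condition in each degree separately; in degree 0
    there are no coboundaries, so the component of f is 0 there. *)
Lemma path_diagonal_ker f : path_diagonal f = 0 -> f \in ideal.
Proof.
move=> f0; have [N ->] := path_algebra_split f; apply: rpred_sum => k _.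
have /path_class_eq0 : path_class k k f = 0.
  by rewrite -[LHS]/((val (path_diagonal f) : mhring d) k k) f0.
case: (k : nat) => [|k'] /=; first by move=> ->; rewrite raddf0 rpred0.
by case=> psi ->; apply: pathsum_cobdry_in_ideal.
Qed.

End DiagonalCochains.

Theorem theorem6p2 (T : finType) (e : rel T)
    (e_sym : symmetric e) (e_irr : irreflexive e) :
  exists f : {rmorphism diagonal_mhring (gdist e) -> path_quotient e},
    bijective f /\
    forall (k : nat) (x : diagonal_mhring (gdist e)),
      diagonal_homog k x <-> path_quotient_homog k (f x).
Proof.
have [a|f [f_bij fE]] := quotring_iso (h := path_diagonal e_irr)
  (S := relators (e := e)) (path_diagonal_surj e_irr).
  by split; [exact: path_diagonal_ker|exact: path_diagonal_ideal_eq0].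
exists f; split=> // k x; split=> [/path_diagonal_homog_surj|[a ak fx]].
  by move=> /(_ e_irr)[a [ak <-]]; exists a; rewrite ?fE.
have -> : x = path_diagonal e_irr a by apply: (bij_inj f_bij); rewrite fx -fE.
exact: path_diagonal_homog.
Qed.
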